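(* Let $(H,\alpha)$ be a finite-dimensional monoidal Hom-Hopf algebra over a field $k$ with antipode $S$, and let $(H^{op}\bowtie H^{\ast},\alpha\otimes(\alpha^{-1})^{\ast})$ be its Drinfel'd double. Let $\{h_{i}\}$ be a basis of $H$ and $\{h^{*}_{i}\}$ the dual basis of $H^{\ast}$. Then $$R=\sum_{i} (1_H\ltimes h^{*}_{i})\otimes (S^{-1}(h_{i})\ltimes \varepsilon_H)$$ is a quasitriangular structure on $(H^{op}\bowtie H^{\ast},\alpha\otimes(\alpha^{-1})^{\ast})$, i.e. $(H^{op}\bowtie H^{\ast},\alpha\otimes(\alpha^{-1})^{\ast},R)$ is a quasitriangular monoidal Hom-Hopf algebra.
   Context: All vector spaces, tensor products and linear maps are over a fixed field $k$; Sweedler notation $\Delta(c)=\sum c_1\otimes c_2$ is used, with $k_{21}\otimes k_{22}=\Delta(k_2)$. Monoidal Hom-algebra $(A,\alpha)$: a vector space $A$ with a linear automorphism $\alpha$, a linear multiplication $a\otimes b\mapsto ab$ and an element $1_A$ with $\alpha(a)(bc)=(ab)\alpha(c)$, $a1_A=\alpha(a)=1_Aa$, $\alpha(ab)=\alpha(a)\alpha(b)$, $\alpha(1_A)=1_A$. Monoidal Hom-coalgebra $(C,\gamma)$: a vector space $C$ with a linear automorphism $\gamma$ and linear maps $\Delta:C\to C\otimes C$, $\varepsilon:C\to k$ with $\sum\gamma^{-1}(c_1)\otimes\Delta(c_2)=\sum\Delta(c_1)\otimes\gamma^{-1}(c_2)$, $\sum c_1\varepsilon(c_2)=\sum\varepsilon(c_1)c_2=\gamma^{-1}(c)$,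 $\Delta(\gamma(c))=\sum\gamma(c_1)\otimes\gamma(c_2)$, $\varepsilon(\gamma(c))=\varepsilon(c)$. Monoidal Hom-bialgebra: $(H,\alpha)$ which is both a monoidal Hom-algebra and a monoidal Hom-coalgebra (same $\alpha$), with $\Delta$ and $\varepsilon$ multiplicative and unital (componentwise product on $H\otimes H$). Monoidal Hom-Hopf algebra: a monoidal Hom-bialgebra with a linear map $S:H\to H$ (antipode) such that $S\alpha=\alpha S$ and $\sum S(h_1)h_2=\varepsilon(h)1=\sum h_1S(h_2)$. For finite-dimensional $H$ the antipode is bijective. For finite-dimensional $(H,\alpha)$, the dual $(H^{\ast},(\alpha^{-1})^{\ast})$, where $(\alpha^{-1})^{\ast}(f)=f\circ\alpha^{-1}$, is a monoidal Hom-Hopf algebra with product $\langle fg,a\rangle=\sum\langle f,a_1\rangle\langle g,a_2\rangle$, unit $\varepsilon_H$, coproduct determined by $\sum\langle f_1,a\rangle\langle f_2,b\rangle=\langle f,ab\rangle$, counit $f\mapsto f(1_H)$. Drinfel'd double: $H^{op}\bowtie H^{\ast}$ is the monoidal Hom-Hopf algebra with underlying vector space $H\otimes H^{\ast}$ (write $h\ltimes f$ for $h\otimes f$), twisting automorphism $\alpha\otimes(\alpha^{-1})^{\ast}$, unit $1_H\ltimes\varepsilon_H$, coproduct $\Delta(h\ltimes f)=\sum(h_1\ltimes f_1)\otimes(h_2\ltimes f_2)$, counit $\varepsilon(h\ltimes f)=\varepsilon_H(h)f(1_H)$, and product $$(h\ltimes f)(k\ltimes g)=\sum \alpha^{2}(k_{21})h\ltimes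 \langle f,S(k_{1})(\alpha^{-2}(?)k_{22})\rangle g,$$ where products of elements of $H$ are taken in $H$, $?$ is the argument of the functional, and the product with $g$ is taken in $H^{\ast}$. Quasitriangular monoidal Hom-Hopf algebra: a monoidal Hom-Hopf algebra $(A,\gamma)$ with an element $R=\sum R^{(1)}\otimes R^{(2)}\in A\otimes A$ satisfying (1) $(\varepsilon\otimes id)R=(id\otimes\varepsilon)R=1$; (2) $\Delta^{op}(x)R=R\Delta(x)$ for all $x\in A$, where $\Delta^{op}(x)=\sum x_2\otimes x_1$; (3) $(\Delta\otimes\gamma^{-1})R=R^{13}R^{23}$; (4) $(\gamma^{-1}\otimes\Delta)R=R^{13}R^{12}$. Here $R^{12}=\sum R^{(1)}\otimes R^{(2)}\otimes1$, $R^{13}=\sum R^{(1)}\otimes1\otimes R^{(2)}$, $R^{23}=\sum1\otimes R^{(1)}\otimes R^{(2)}$ in $A\otimes A\otimes A$ with componentwise product. *)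

(* Defs.v *)
From HB Require Import structures.
From mathcomp Require Import all_boot all_order all_algebra.

Set Implicit Arguments.
Unset Strict Implicit.
Unset Printing Implicit Defensive.

Import GRing.Theory.
Local Open Scope ring_scope.

(* All spaces are finite dimensional. The tensor product of U and V is modelled
   by coefficient matrices with respect to the bases vbasis {:U} and
   vbasis {:V}; tlift_tens and tens_ext below are its universal property. *)

Section Tensor.
Variable k : fieldType.
Implicit Types U V W : vectType k.

Definition tensor U V : vectType k := 'M[k]_(\dim {:U}, \dim {:V}).

Definition tens U V (u : U) (v : V) : tensor U V :=
  \matrix_(i, j) (coord (vbasis {:U}) i u * coord (vbasis {:V}) j v).

Definition tlift_fun U V W (f : U -> V -> W) (t : tensor U V) : W :=
  \sum_i \sum_j
    (t : 'M[k]_(_, _)) i j *: f (vbasis {:U})`_i (vbasis {:V})`_j.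

(* The linear map induced on U (x) V by f, meaningful when f is bilinear. *)
Definition tlift U V W (f : U -> V -> W) : 'Hom(tensor U V, W) :=
  linfun (tlift_fun f).

End Tensor.

Notation "u \ox v" := (tens u v) (at level 40, left associativity).

(* Sweedler notation: if t = Delta c and E is bilinear in a and b, then
   sw( a , b <- t ) E is the sum written E(c_1, c_2). *)
Notation "'sw(' a , b <- t ) E" := (tlift (fun a b => E) t)
  (at level 200, a name, b name, t at level 100, E at level 200).

Section TensorTheory.
Variable k : fieldType.
Implicit Types U V W : vectType k.

Definition bilin U V W (f : U -> V -> W) : Prop :=
  (forall v, linear (f^~ v)) /\ (forall u, linear (f u)).

Lemma tliftE U V W (f : U -> V -> W) t : tlift f t = tlift_fun f t.
Proof.
have lf : linear (tlift_fun f).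
  move=> a s t'; rewrite /tlift_fun scaler_sumr -big_split /=.
  apply: eq_bigr => i _; rewrite scaler_sumr -big_split /=.
  by apply: eq_bigr => j _; rewrite !mxE scalerDl scalerA.
pose L := GRing.isLinear.Build _ _ _ _ _ lf.
pose F : {linear _ -> _} := HB.pack (tlift_fun f) L.
exact: (lfunE F).
Qed.

Lemma tens_bilin U V : bilin (@tens k U V).
Proof.
by split=> w a x y; apply/matrixP=> i j; rewrite !mxE linearP /=
  ?mulrDl ?mulrDr ?mulrA // [_ * a]mulrC.
Qed.

Lemma bilin_suml U V W (f : U -> V -> W) : bilin f ->
  forall (I : finType) (c : I -> k) (u : I -> U) v,
    f (\sum_i c i *: u i) v = \sum_i c i *: f (u i) v.
Proof.
move=> [fl _] I c u v.
pose L := GRing.isLinear.Build _ _ _ _ _ (fl v).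
pose F : {linear _ -> _} := HB.pack (f^~ v) L.
rewrite -[LHS]/(F _) linear_sum; apply: eq_bigr => i _.
by rewrite linearZ.
Qed.

Lemma bilin_sumr U V W (f : U -> V -> W) : bilin f ->
  forall (I : finType) (c : I -> k) (v : I -> V) u,
    f u (\sum_i c i *: v i) = \sum_i c i *: f u (v i).
Proof.
move=> [fl fr] I c v u.
by apply: (@bilin_suml V U W (fun x y => f y x)); split.
Qed.

Lemma tlift_tens U V W (f : U -> V -> W) : bilin f ->
  forall u v, tlift f (u \ox v) = f u v.
Proof.
move=> bf u v; rewrite tliftE /tlift_fun.
rewrite {2}(coord_vbasis (memvf u)) (bilin_suml bf).
apply: eq_bigr => i _.
rewrite {2}(coord_vbasis (memvf v)) (bilin_sumr bf) scaler_sumr.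
by apply: eq_bigr => j _; rewrite mxE scalerA.
Qed.

Lemma tens_gen U V (t : tensor U V) : tlift (@tens k U V) t = t.
Proof.
rewrite tliftE /tlift_fun; apply/matrixP => i j.
rewrite summxE (bigD1 i) //= summxE (bigD1 j) //= !mxE.
rewrite !coord_free ?(basis_free (vbasisP _)) // !eqxx !mulr1.
rewrite !big1 ?addr0 // => [i' ni|j' nj].
  rewrite summxE big1 // => j' _.
  by rewrite !mxE !coord_free ?(basis_free (vbasisP _)) //
    (negPf ni) mul0r mulr0.
by rewrite !mxE !coord_free ?(basis_free (vbasisP _)) //
  (negPf nj) !mulr0.
Qed.

Lemma tens_ext U V W (F G : 'Hom(tensor U V, W)) :
  (forall u v, F (u \ox v) = G (u \ox v)) -> F = G.
Proof.
move=> FG; apply/lfunP => t; rewrite -[t]tens_gen tliftE /tlift_fun.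
rewrite !linear_sum; apply: eq_bigr => i _; rewrite !linear_sum.
by apply: eq_bigr => j _; rewrite !linearZ /= FG.
Qed.

Lemma tlift_linear U V W (X : lmodType k) (f : X -> U -> V -> W) (t : tensor U V) :
  (forall u v, linear (fun x : X => f x u v)) ->
  linear (fun x => tlift (f x) t).
Proof.
move=> lf a x y; rewrite !tliftE /tlift_fun scaler_sumr -big_split /=.
apply: eq_bigr => i _; rewrite scaler_sumr -big_split /=.
by apply: eq_bigr => j _; rewrite lf scalerDr !scalerA mulrC.
Qed.

Lemma linfun_linE U V (f : U -> V) (u : U) : linear f -> linfun f u = f u.
Proof.
move=> lf; pose L := GRing.isLinear.Build _ _ _ _ _ lf.
pose F : {linear _ -> _} := HB.pack f L.
exact: (lfunE F).
Qed.

Definition tmap U V U' V' (f : 'Hom(U, U')) (g : 'Hom(V, V')) :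
    'Hom(tensor U V, tensor U' V') :=
  tlift (fun u v => f u \ox g v).

Definition tswap U V : 'Hom(tensor U V, tensor V U) :=
  tlift (fun u v => v \ox u).

Definition tassoc U V W :
    'Hom(tensor (tensor U V) W, tensor U (tensor V W)) :=
  tlift (fun t w => sw( u , v <- t ) u \ox (v \ox w)).

Definition tmul U V (mU : U -> U -> U) (mV : V -> V -> V) :
    tensor U V -> tensor U V -> tensor U V :=
  fun s t => sw( a , b <- s ) sw( c , d <- t ) mU a c \ox mV b d.

(* The canonical map U^* (x) V^* -> (U (x) V)^*, bijective because U and V are
   finite dimensional. *)
Definition tpair U V :
    'Hom(tensor 'Hom(U, k^o) 'Hom(V, k^o), 'Hom(tensor U V, k^o)) :=
  tlift (fun (f : 'Hom(U, k^o)) (g : 'Hom(V, k^o)) =>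
           tlift (fun u v => (f u * g v : k^o))).

Lemma mul_bilin U V (f : 'Hom(U, k^o)) (g : 'Hom(V, k^o)) :
  bilin (fun u v => (f u * g v : k^o)).
Proof.
split=> w a x y; rewrite linearP; first by rewrite mulrDl -mulrA.
by rewrite mulrDr mulrCA.
Qed.

Lemma tpairE U V (f : 'Hom(U, k^o)) (g : 'Hom(V, k^o)) u v :
  tpair U V (f \ox g) (u \ox v) = f u * g v.
Proof.
rewrite /tpair tlift_tens ?tlift_tens //; first exact: mul_bilin.
split=> h a x y; apply: tens_ext => {}u {}v;
  rewrite add_lfunE scale_lfunE !tlift_tens; try exact: mul_bilin.
  by rewrite add_lfunE scale_lfunE mulrDl -mulrA.
by rewrite add_lfunE scale_lfunE mulrDr mulrCA.
Qed.

Lemma tpair_surj U V (F : 'Hom(tensor U V, k^o)) :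
  tpair U V ((tpair U V)^-1%VF F) = F.
Proof.
rewrite limg_lfunVK //.
pose c (W : vectType k) i : 'Hom(W, k^o) :=
  linfun (coord (vbasis {:W}) i : W -> k^o).
have cE (W : vectType k) i (w : W) : c W i w = coord (vbasis {:W}) i w.
  by apply: linfun_linE => a x y; rewrite linearP.
pose s := \sum_(i < \dim {:U}) \sum_(j < \dim {:V})
  (F ((vbasis {:U})`_i \ox (vbasis {:V})`_j) : k) *: (c U i \ox c V j).
suff -> : F = tpair U V s by rewrite memv_img ?memvf.
apply: tens_ext => u v.
rewrite /s linear_sum sum_lfunE {1}(coord_vbasis (memvf u)).
rewrite (bilin_suml (tens_bilin U V)) linear_sum; apply: eq_bigr => i _.
rewrite linear_sum sum_lfunE {1}(coord_vbasis (memvf v)).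
rewrite linearZ (bilin_sumr (tens_bilin U V)) linear_sum /= scaler_sumr.
apply: eq_bigr => j _.
rewrite !linearZ scale_lfunE tpairE !cE /= scalerA [_ * coord _ i u]mulrC.
exact: mulrC.
Qed.

End TensorTheory.

Section MonoidalHom.
Variable k : fieldType.

(* (f^-1)%VF is a two-sided inverse only for bijective f. It is used below for
   the twist, which is bijective by assumption, for tpair, which is surjective
   by tpair_surj, and will be used for the antipode, which is bijective because
   the space is finite dimensional. *)

Record hom_data (A : vectType k) := HomData {
  twist : 'End(A);
  mult : 'Hom(tensor A A, A);
  hone : A;
  comult : 'Hom(A, tensor A A);
  counit : 'Hom(A, k^o)
}.

Definition hmul A (D : hom_data A) (a b : A) : A := mult D (a \ox b).

Record is_hom_algebra A (D : hom_data A) : Prop := IsHomAlgebra {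
  twist_bij_alg : bijective (twist D);
  hmulA : forall a b c,
    hmul D (twist D a) (hmul D b c) = hmul D (hmul D a b) (twist D c);
  hmul1r : forall a, hmul D a (hone D) = twist D a;
  hmul1l : forall a, hmul D (hone D) a = twist D a;
  twistM : forall a b, twist D (hmul D a b) = hmul D (twist D a) (twist D b);
  twist1 : twist D (hone D) = hone D
}.

Record is_hom_coalgebra C (D : hom_data C) : Prop := IsHomCoalgebra {
  twist_bij_coalg : bijective (twist D);
  comultA : forall c,
    tmap (twist D)^-1%VF (comult D) (comult D c) =
    tassoc _ _ _ (tmap (comult D) (twist D)^-1%VF (comult D c));
  counitr : forall c,
    (sw( c1 , c2 <- comult D c ) (counit D c2 : k) *: c1) = (twist D)^-1%VF c;
  counitl : forall c,
    (sw( c1 , c2 <- comult D c ) (counit D c1 : k) *: c2) = (twist D)^-1%VF c;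
  comult_twist : forall c,
    comult D (twist D c) = tmap (twist D) (twist D) (comult D c);
  counit_twist : forall c, counit D (twist D c) = counit D c
}.

Record is_hom_bialgebra H (D : hom_data H) : Prop := IsHomBialgebra {
  bialg_alg : is_hom_algebra D;
  bialg_coalg : is_hom_coalgebra D;
  comultM : forall a b,
    comult D (hmul D a b) = tmul (hmul D) (hmul D) (comult D a) (comult D b);
  comult1 : comult D (hone D) = hone D \ox hone D;
  counitM : forall a b,
    counit D (hmul D a b) = (counit D a : k) * (counit D b : k);
  counit1 : counit D (hone D) = 1
}.

Record is_antipode H (D : hom_data H) (S : 'End(H)) : Prop := IsAntipode {
  antipode_twist : forall h, S (twist D h) = twist D (S h);
  antipodel : forall h,
    (sw( h1 , h2 <- comult D h ) hmul D (S h1) h2) =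
    (counit D h : k) *: hone D;
  antipoder : forall h,
    (sw( h1 , h2 <- comult D h ) hmul D h1 (S h2)) =
    (counit D h : k) *: hone D
}.

Definition is_hom_hopf H (D : hom_data H) : Prop :=
  is_hom_bialgebra D /\ exists S, is_antipode D S.

(* A (x) A (x) A is bracketed to the left. *)
Definition R12 A (D : hom_data A) (R : tensor A A) : tensor (tensor A A) A :=
  sw( a , b <- R ) a \ox b \ox hone D.
Definition R13 A (D : hom_data A) (R : tensor A A) : tensor (tensor A A) A :=
  sw( a , b <- R ) a \ox hone D \ox b.
Definition R23 A (D : hom_data A) (R : tensor A A) : tensor (tensor A A) A :=
  sw( a , b <- R ) hone D \ox a \ox b.

Definition hmul2 A (D : hom_data A) := tmul (hmul D) (hmul D).
Definition hmul3 A (D : hom_data A) := tmul (hmul2 D) (hmul D).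

Record is_quasitriangular A (D : hom_data A) (R : tensor A A) : Prop :=
IsQuasitriangular {
  qt_hopf : is_hom_hopf D;
  qt_counitl : (sw( a , b <- R ) (counit D a : k) *: b) = hone D;
  qt_counitr : (sw( a , b <- R ) (counit D b : k) *: a) = hone D;
  qt_comm : forall x,
    hmul2 D (tswap _ _ (comult D x)) R = hmul2 D R (comult D x);
  qt_comultl :
    tmap (comult D) (twist D)^-1%VF R = hmul3 D (R13 D R) (R23 D R);
  qt_comultr :
    tmap (twist D)^-1%VF (comult D) R =
    tassoc _ _ _ (hmul3 D (R13 D R) (R12 D R))
}.

Lemma hmul_bilin A (D : hom_data A) : bilin (hmul D).
Proof.
have [tl tr] := tens_bilin A A.
by split=> u a x y; rewrite /hmul (tl, tr) linearP.
Qed.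

Section Dual.
Variables (H : vectType k) (D : hom_data H).
Notation Hd := 'Hom(H, k^o).

Definition dual_twist_fun (f : Hd) : Hd := (f \o (twist D)^-1)%VF.

Definition dual_mul_fun (f g : Hd) : Hd :=
  linfun (fun a => sw( a1 , a2 <- comult D a ) (f a1 * g a2 : k^o)).

(* f \o mult D lies in (H (x) H)^*; its preimage under tpair is the element
   f_1 (x) f_2 such that f_1(a) f_2(b) = f(ab), see dual_comultP. *)
Definition dual_comult_fun (f : Hd) : tensor Hd Hd :=
  (tpair H H)^-1%VF (f \o mult D)%VF.

Definition dual_data : hom_data Hd := {|
  twist := linfun dual_twist_fun;
  mult := tlift dual_mul_fun;
  hone := counit D;
  comult := linfun dual_comult_fun;
  counit := linfun (fun f : Hd => f (hone D))
|}.

Lemma dual_mul_bilin : bilin dual_mul_fun.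
Proof.
have lin f g a : dual_mul_fun f g a =
    (sw( a1 , a2 <- comult D a ) (f a1 * g a2 : k^o)).
  by apply: linfun_linE => c x y; rewrite !linearP.
split=> f c x y; apply/lfunP=> a; rewrite !lfunE /= lfunE /= !lin.
  apply: (@tlift_linear k H H k^o Hd (fun e a1 a2 => (e a1 * f a2 : k^o))).
  by move=> u v b x1 x2; rewrite add_lfunE scale_lfunE mulrDl -mulrA.
apply: (@tlift_linear k H H k^o Hd (fun e a1 a2 => (f a1 * e a2 : k^o))).
by move=> u v b x1 x2; rewrite add_lfunE scale_lfunE mulrDr mulrCA.
Qed.

Lemma dual_mulE (f g : Hd) a :
  hmul dual_data f g a = sw( a1 , a2 <- comult D a ) (f a1 * g a2 : k^o).
Proof.
rewrite /hmul /= (tlift_tens dual_mul_bilin).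
by apply: linfun_linE => c x y; rewrite !linearP.
Qed.

Lemma dual_twistE (f : Hd) a : twist dual_data f a = f ((twist D)^-1%VF a).
Proof.
rewrite /= linfun_linE ?lfunE //= => c x y.
by apply/lfunP => z; rewrite /dual_twist_fun !(comp_lfunE, add_lfunE, scale_lfunE).
Qed.

Lemma dual_comultP (f : Hd) a b :
  tpair H H (comult dual_data f) (a \ox b) = f (hmul D a b).
Proof.
rewrite /= (@linfun_linE _ _ _ dual_comult_fun).
  by rewrite /dual_comult_fun tpair_surj comp_lfunE.
move=> c x y; rewrite /dual_comult_fun -linearP; congr (_ _).
by apply/lfunP => t; rewrite !(comp_lfunE, add_lfunE, scale_lfunE).
Qed.

End Dual.

Section Double.
Variables (H : vectType k) (D : hom_data H) (S : 'End(H)).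
Notation Hd := 'Hom(H, k^o).
Notation HH := (tensor H Hd).
Local Notation alpha := (twist D).
Local Notation alphaV := (twist D)^-1%VF.
Local Notation "a ** b" := (hmul D a b) (at level 40, left associativity).

(* < f , S(x) (alpha^-2(?) y) > *)
Definition double_act (f : Hd) (x y : H) : Hd :=
  linfun (fun a => f (S x ** (alphaV (alphaV a) ** y))).

Definition double_mul4 (h : H) (f : Hd) (l : H) (g : Hd) : HH :=
  sw( l1 , l2 <- comult D l ) sw( l21 , l22 <- comult D l2 )
    (alpha (alpha l21) ** h) \ox hmul (dual_data D) (double_act f l1 l22) g.

Definition double_mul_fun (x y : HH) : HH :=
  sw( h , f <- x ) sw( l , g <- y ) double_mul4 h f l g.

Definition double_comult2 (h : H) (f : Hd) : tensor HH HH :=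
  sw( h1 , h2 <- comult D h ) sw( f1 , f2 <- comult (dual_data D) f )
    (h1 \ox f1) \ox (h2 \ox f2).

(* The Drinfel'd double of (H, alpha) with antipode S. *)
Definition double_data : hom_data HH := {|
  twist := tmap alpha (twist (dual_data D));
  mult := tlift double_mul_fun;
  hone := hone D \ox (counit D : Hd);
  comult := tlift double_comult2;
  counit := tlift (fun h (f : Hd) => (counit D h * f (hone D) : k^o))
|}.

Lemma double_actE f x y a :
  double_act f x y a = f (S x ** (alphaV (alphaV a) ** y)).
Proof.
have [ml mr] := hmul_bilin D.
by apply: linfun_linE => c u v; rewrite !linearP /= ml mr linearP.
Qed.

Lemma double_act_linear x y : linear (fun f => double_act f x y).
Proof.
move=> c f g; apply/lfunP => a.
by rewrite !(add_lfunE, scale_lfunE, double_actE).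
Qed.

Lemma double_mulE h f l g :
  hmul double_data (h \ox f) (l \ox g) = double_mul4 h f l g.
Proof.
have [tl tr] := tens_bilin H Hd.
have [ml mr] := hmul_bilin D.
have [dl dr] := hmul_bilin (dual_data D).
have l3 h0 f0 : bilin (double_mul4 h0 f0).
  split=> [g0 c x y|l0]; first by rewrite /double_mul4 !linearP.
  apply: tlift_linear => u v; apply: tlift_linear => u' v' c x y.
  by rewrite dr tr.
have l1 y : bilin (fun h0 f0 => tlift (double_mul4 h0 f0) y).
  split=> [f0|h0]; apply: tlift_linear => l0 g0;
    apply: tlift_linear => u v; apply: tlift_linear => u' v' c x0 y0.
    by rewrite mr tl.
  by rewrite double_act_linear dl tr.
rewrite /hmul /= tlift_tens; last first.
  split=> [y c x x'|x]; first by rewrite /double_mul_fun linearP.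
  by apply: tlift_linear => h0 f0 c y y'; rewrite linearP.
by rewrite /double_mul_fun (tlift_tens (l1 _)) tlift_tens.
Qed.

Lemma double_comultE h f :
  comult double_data (h \ox f) =
  sw( h1 , h2 <- comult D h ) sw( f1 , f2 <- comult (dual_data D) f )
    (h1 \ox f1) \ox (h2 \ox f2).
Proof.
rewrite /= tlift_tens //; split=> [f0 c x y|h0].
  by rewrite /double_comult2 !linearP.
by apply: tlift_linear => u v c x y; rewrite !linearP.
Qed.

End Double.
End MonoidalHom.

(* Main.v *)
Require Import Defs.
From HB Require Import structures.
From mathcomp Require Import all_boot all_order all_algebra.

(* A monoidal Hom-structure is an ordinary structure together with an automorphism:
   composing the product with the automorphism, and the coproduct with its inverse,
   changes the twist by that automorphism. Composing with alpha^-1 turns H into an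
   ordinary Hopf algebra H', and the Drinfel'd double of H is the ordinary double of
   H' composed with the automorphism alpha \ox (alpha^-1)^*, which fixes R. This
   reduces the theorem to ordinary Hopf algebras.

   There, elements of H \ox H^* are treated as endomorphisms of H; both sides of each
   axiom are evaluated at elements of H and compared by Sweedler calculus. The
   antipode is bijective because H^*, as a Hopf module over H, has a non-zero left
   integral l, and S(h) = 0 makes l(x) h vanish for all x. *)

Set Implicit Arguments.
Unset Strict Implicit.
Unset Printing Implicit Defensive.

Import GRing.Theory.
Local Open Scope ring_scope.

(** * Linearity *)

Section Lin.
Variable k : fieldType.
Implicit Types U V W : vectType k.

(** Evaluation is forced by the dual coproduct. It is defined as an inverse image under [tpair] and
    has no closed formula, but evaluating its two legs at a and b gives f(ab); so functionals on H
    drop out and only products and coproducts of H remain. Evaluation also removes the basis from R,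
    which becomes the assignment of 1 \ox ε(b) S^{-1}(a) to a and b. Untwisting comes first because
    in the Hom-setting every reassociation shifts a power of alpha; with identity twist the legs can
    be regrouped freely, and each axiom becomes a chain of cancellations of adjacent factors such as
    x_1 S(x_2). As [(S^-1)%VF] is only a generalised inverse in general, nothing can be said about R
    before S is known to be injective. The integral needed for this is obtained from the projection
    of a Hopf module onto its coinvariants; the coaction on H^* sends m to the sum of f_i m \ox e_i
    over dual bases, which is why sums over a basis occur there. *)

Lemma lin_id (X : lmodType k) : linear (fun x : X => x). Proof. by []. Qed.

Lemma lin_app (X : lmodType k) V W (L : 'Hom(V, W)) (f : X -> V) :
  linear f -> linear (fun x => L (f x)).
Proof. by move=> lf c x y; rewrite lf linearP. Qed.

Lemma lin_comp (X : lmodType k) V W (L : V -> W) (f : X -> V) :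
  linear L -> linear f -> linear (fun x => L (f x)).
Proof. by move=> lL lf c x y; rewrite lf lL. Qed.

Lemma lin_lfun V W (L : 'Hom(V, W)) : linear L.
Proof. by move=> c x y; rewrite linearP. Qed.

Lemma lin_at (X : lmodType k) V W (a : V) (f : X -> 'Hom(V, W)) :
  linear f -> linear (fun x => f x a).
Proof. by move=> lf c x y; rewrite lf add_lfunE scale_lfunE. Qed.

Lemma lin_tensl (X : lmodType k) U V (f : X -> U) (v : V) :
  linear f -> linear (fun x => f x \ox v).
Proof. by move=> lf c x y; rewrite lf; have [-> _] := tens_bilin U V. Qed.

Lemma lin_tensr (X : lmodType k) U V (f : X -> V) (u : U) :
  linear f -> linear (fun x => u \ox f x).
Proof. by move=> lf c x y; rewrite lf; have [_ ->] := tens_bilin U V. Qed.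

Lemma lin_hmull (X : lmodType k) V (D : hom_data V) (f : X -> V) (v : V) :
  linear f -> linear (fun x => hmul D (f x) v).
Proof. by move=> lf c x y; rewrite lf; have [-> _] := hmul_bilin D. Qed.

Lemma lin_hmulr (X : lmodType k) V (D : hom_data V) (f : X -> V) (u : V) :
  linear f -> linear (fun x => hmul D u (f x)).
Proof. by move=> lf c x y; rewrite lf; have [_ ->] := hmul_bilin D. Qed.

Lemma lin_scalel (X : lmodType k) V (f : X -> k^o) (v : V) :
  linear f -> linear (fun x => (f x : k) *: v).
Proof. by move=> lf c x y; rewrite lf scalerDl scalerA. Qed.

Lemma lin_scaler (X : lmodType k) V (c : k) (f : X -> V) :
  linear f -> linear (fun x => c *: f x).
Proof. by move=> lf d x y; rewrite lf scalerDr !scalerA mulrC. Qed.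

Lemma lin_mull (X : lmodType k) (f : X -> k^o) (c : k) :
  linear f -> linear (fun x => ((f x : k) * c : k^o)).
Proof. by move=> lf d x y; rewrite lf mulrDl -mulrA. Qed.

Lemma lin_mulr (X : lmodType k) (f : X -> k^o) (c : k) :
  linear f -> linear (fun x => (c * (f x : k) : k^o)).
Proof. by move=> lf d x y; rewrite lf mulrDr mulrCA. Qed.

Lemma lin_linfun (X : lmodType k) V W (F : X -> V -> W) :
  (forall x, linear (F x)) -> (forall a, linear (fun x => F x a)) ->
  linear (fun x => linfun (F x)).
Proof.
move=> l1 l2 c x y; apply/lfunP => a.
by rewrite add_lfunE scale_lfunE !linfun_linE // l2.
Qed.

Lemma lin_body (X : lmodType k) U V W (f : X -> U -> V -> W) (t : tensor U V) :
  (forall u v, linear (fun x : X => f x u v)) ->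
  linear (fun x => tlift (f x) t).
Proof. exact: tlift_linear. Qed.

Lemma lin_sum (X : lmodType k) W (I : finType) (f : I -> X -> W) :
  (forall i, linear (f i)) -> linear (fun x => \sum_i f i x).
Proof.
move=> lf c x y; rewrite scaler_sumr -big_split /=.
by apply: eq_bigr => i _; rewrite lf.
Qed.

Lemma lin_bilin U V W (f : U -> V -> W) :
  (forall v, linear (fun u => f u v)) -> (forall u, linear (fun v => f u v)) ->
  bilin f.
Proof. by split. Qed.

Definition trilin U V W (X : vectType k) (F : U -> V -> W -> X) : Prop :=
  [/\ forall v w, linear (fun u => F u v w), forall u w, linear (fun v => F u v w)
    & forall u v, linear (fun w => F u v w)].

Lemma lin_bilinl (X : lmodType k) U V W (m : U -> V -> W) (f : X -> U) v :
  bilin m -> linear f -> linear (fun x => m (f x) v).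
Proof. by move=> [l _] lf c x y; rewrite lf l. Qed.

Lemma lin_bilinr (X : lmodType k) U V W (m : U -> V -> W) (f : X -> V) u :
  bilin m -> linear f -> linear (fun x => m u (f x)).
Proof. by move=> [_ r] lf c x y; rewrite lf r. Qed.

Lemma lin_trilin1 (X : lmodType k) U V W (Y : vectType k) (m : U -> V -> W -> Y) (f : X -> U) v w :
  trilin m -> linear f -> linear (fun x => m (f x) v w).
Proof. by move=> [l _ _] lf c x y; rewrite lf l. Qed.

Lemma lin_trilin2 (X : lmodType k) U V W (Y : vectType k) (m : U -> V -> W -> Y) (f : X -> V) u w :
  trilin m -> linear f -> linear (fun x => m u (f x) w).
Proof. by move=> [_ l _] lf c x y; rewrite lf l. Qed.

Lemma lin_trilin3 (X : lmodType k) U V W (Y : vectType k) (m : U -> V -> W -> Y) (f : X -> W) u v :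
  trilin m -> linear f -> linear (fun x => m u v (f x)).
Proof. by move=> [_ _ l] lf c x y; rewrite lf l. Qed.
End Lin.

(** [tlift] accepts any function, so most Sweedler steps leave linearity goals. They are solved by
    the shape of the term: each case peels off one operation through which the variable passes. *)
Ltac lin_step := first
 [ exact: lin_id
 | assumption
 | exact: lin_lfun
 | refine (lin_bilin _ _)
 | match goal with |- trilin _ => split end
 | match goal with |- forall _, _ => intro; cbv beta end
 | refine (lin_hmull _ _)
 | refine (lin_hmulr _ _)
 | refine (lin_tensl _ _)
 | refine (lin_tensr _ _)
 | refine (lin_body _ _)
 | refine (lin_linfun _ _)
 | refine (lin_app _ _)
 | refine (lin_scaler _ _)
 | refine (lin_scalel _ _)
 | refine (lin_mulr _ _)
 | refine (lin_mull _ _)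
 | refine (lin_sum _)
 | match goal with h : bilin _ |- _ =>
     first [refine (lin_bilinl _ h _) | refine (lin_bilinr _ h _)] end
 | match goal with h : trilin _ |- _ =>
     first [refine (lin_trilin1 _ _ h _) | refine (lin_trilin2 _ _ h _)
           | refine (lin_trilin3 _ _ h _)] end
 | match goal with h : GRing.linear_for _ _ |- _ => refine (lin_comp h _) end
 | refine (lin_at _ _) ].
Ltac lin := repeat lin_step.

(** * Tensor products *)

Section TensorMore.
Variable k : fieldType.
Implicit Types U V W : vectType k.

Lemma eq_tlift U V W (f g : U -> V -> W) t :
  (forall u v, f u v = g u v) -> tlift f t = tlift g t.
Proof.
move=> fg; rewrite !tliftE /tlift_fun.
by apply: eq_bigr => i _; apply: eq_bigr => j _; rewrite fg.
Qed.

Lemma linear_sumE (X Y : lmodType k) (L : X -> Y) (I : finType) (c : I -> k) (f : I -> X) :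
  linear L -> L (\sum_i c i *: f i) = \sum_i c i *: L (f i).
Proof.
move=> lL; pose M := GRing.isLinear.Build _ _ _ _ _ lL.
pose F : {linear _ -> _} := HB.pack L M.
by rewrite -[L]/(F : X -> Y) linear_sum; apply: eq_bigr => i _; rewrite linearZ.
Qed.

Lemma linear_sum1 (X Y : lmodType k) (L : X -> Y) (I : finType) (f : I -> X) :
  linear L -> L (\sum_i f i) = \sum_i L (f i).
Proof.
move=> lL; pose M := GRing.isLinear.Build _ _ _ _ _ lL.
pose F : {linear _ -> _} := HB.pack L M.
by rewrite -[L]/(F : X -> Y) linear_sum.
Qed.

Lemma linear_scaleE (X Y : lmodType k) (L : X -> Y) c x :
  linear L -> L (c *: x) = c *: L x.
Proof.
move=> lL; pose M := GRing.isLinear.Build _ _ _ _ _ lL.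
pose F : {linear _ -> _} := HB.pack L M.
by rewrite -[L]/(F : X -> Y) linearZ.
Qed.

Lemma linear_0 (X Y : lmodType k) (L : X -> Y) : linear L -> L 0 = 0.
Proof. by move=> lL; rewrite -[X in L X](scale0r 0) linear_scaleE // scale0r. Qed.

Lemma tens_ind U V (X : lmodType k) (f g : tensor U V -> X) :
  linear f -> linear g -> (forall u v, f (u \ox v) = g (u \ox v)) -> f =1 g.
Proof.
move=> lf lg fg t; rewrite -[t]tens_gen tliftE /tlift_fun !linear_sum1 //.
apply: eq_bigr => i _; rewrite !linear_sum1 //; apply: eq_bigr => j _.
by rewrite !linear_scaleE // fg.
Qed.

Lemma map_tlift U V W W' (L : W -> W') (f : U -> V -> W) t :
  linear L -> L (tlift f t) = tlift (fun u v => L (f u v)) t.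
Proof.
move=> lL; rewrite !tliftE /tlift_fun linear_sum1 //; apply: eq_bigr => i _.
by rewrite linear_sumE.
Qed.

Lemma tlift_comp U V U' V' W (F : U -> V -> W) (G : U' -> V' -> tensor U V) t :
  tlift F (tlift G t) = tlift (fun a b => tlift F (G a b)) t.
Proof. by rewrite (map_tlift (L := tlift F)) // => c x y; rewrite linearP. Qed.

Lemma tlift_sum U V W (I : finType) (f : I -> U -> V -> W) t :
  tlift (fun u v => \sum_i f i u v) t = \sum_i tlift (f i) t.
Proof.
rewrite tliftE /tlift_fun.
under eq_bigr => i _ do under eq_bigr => j _ do rewrite scaler_sumr.
under eq_bigr => i _ do rewrite exchange_big.
by rewrite exchange_big; apply: eq_bigr => i _; rewrite tliftE.
Qed.

Lemma tliftZ U V W (f : U -> V -> W) (c : k) t :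
  tlift (fun u v => c *: f u v) t = c *: tlift f t.
Proof. by rewrite (map_tlift (L := fun x => c *: x)) //; lin. Qed.

(** Both sides are the same sum over pairs of basis tensors, taken in two orders. *)
Lemma tlift_exch U V U' V' W (F : U -> V -> U' -> V' -> W) s t :
  tlift (fun a b => tlift (fun c d => F a b c d) t) s =
  tlift (fun c d => tlift (fun a b => F a b c d) s) t.
Proof.
rewrite [LHS]tliftE /tlift_fun.
under [RHS]eq_tlift => c d do rewrite tliftE /tlift_fun.
rewrite tlift_sum; apply: eq_bigr => i _; rewrite tlift_sum.
by apply: eq_bigr => j _; rewrite tliftZ.
Qed.

Lemma tlift_tmap U V U' V' W (F : U' -> V' -> W) (f : 'Hom(U, U')) (g : 'Hom(V, V')) t :
  bilin F -> tlift F (tmap f g t) = tlift (fun u v => F (f u) (g v)) t.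
Proof.
by move=> bF; rewrite /tmap tlift_comp; apply: eq_tlift => u v; rewrite tlift_tens.
Qed.

Lemma tlift_swap U V W (F : V -> U -> W) (t : tensor U V) :
  bilin F -> tlift F (tswap U V t) = tlift (fun u v => F v u) t.
Proof.
by move=> bF; rewrite /tswap tlift_comp; apply: eq_tlift => u v; rewrite tlift_tens.
Qed.

Lemma tmap_tens U V U' V' (f : 'Hom(U, U')) (g : 'Hom(V, V')) u v :
  tmap f g (u \ox v) = f u \ox g v.
Proof. by rewrite /tmap tlift_tens //; lin. Qed.

Lemma tswap_tens U V (u : U) (v : V) : tswap U V (u \ox v) = v \ox u.
Proof. by rewrite /tswap tlift_tens //; lin. Qed.

Lemma tmap_comp U V U' V' U2 V2 (f : 'Hom(U, U')) (g : 'Hom(V, V'))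
  (f' : 'Hom(U', U2)) (g' : 'Hom(V', V2)) t :
  tmap f' g' (tmap f g t) = tmap (f' \o f)%VF (g' \o g)%VF t.
Proof.
rewrite [LHS]tlift_tmap; last by lin.
by apply: eq_tlift => u v; rewrite !comp_lfunE.
Qed.

Lemma tassoc_tens U V W (u : U) (v : V) (w : W) :
  tassoc U V W (u \ox v \ox w) = u \ox (v \ox w).
Proof. by rewrite /tassoc tlift_tens ?tlift_tens //; lin. Qed.

Lemma tmul_bilin U V (mU : U -> U -> U) (mV : V -> V -> V) :
  bilin mU -> bilin mV -> bilin (tmul mU mV).
Proof.
by move=> bU bV; rewrite /tmul; lin.
Qed.

Lemma tmul_tens U V (mU : U -> U -> U) (mV : V -> V -> V) a b c d :
  bilin mU -> bilin mV ->
  tmul mU mV (a \ox b) (c \ox d) = mU a c \ox mV b d.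
Proof.
by move=> bU bV; rewrite /tmul tlift_tens ?tlift_tens //; lin.
Qed.

Lemma tens_coord U V (t : tensor U V) i j :
  coord (vbasis {:V}) j (tlift (fun u v => (coord (vbasis {:U}) i u) *: v) t)
  = (t : 'M[k]_(_, _)) i j.
Proof.
rewrite -{2}[t]tens_gen (map_tlift (L := fun v : V => (coord (vbasis {:V}) j v : k^o))); last first.
  by move=> c x y; rewrite linearP.
rewrite (map_tlift (L := fun m : tensor U V => ((m : 'M[k]_(_, _)) i j : k^o))); last first.
  by move=> c x y; rewrite !mxE.
by refine (@eq_tlift U V k^o _ _ _ _) => u v; rewrite !mxE linearZ.
Qed.

Lemma tens_scalar (a b : k^o) :
  a \ox b = ((a : k) * (b : k)) *: ((1 : k^o) \ox (1 : k^o)).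
Proof.
rewrite -{1}[a]mulr1 -{1}[b]mulr1 -[a * 1]/(a *: (1 : k^o)) -[b * 1]/(b *: (1 : k^o)).
rewrite (linear_scaleE (L := fun u : k^o => u \ox (_ : k^o))); last by lin.
by rewrite (linear_scaleE (L := fun u : k^o => (_ : k^o) \ox u)) ?scalerA //; lin.
Qed.

Definition cobasis W i : 'Hom(W, k^o) :=
  linfun (coord (vbasis {:W}) i : W -> k^o).

Lemma cobasisE W i (w : W) : cobasis i w = coord (vbasis {:W}) i w.
Proof. by apply: linfun_linE => a x y; rewrite linearP. Qed.

Lemma cobasis_sum W (w : W) : w = \sum_i (cobasis i w : k) *: (vbasis {:W})`_i.
Proof. by rewrite {1}(coord_vbasis (memvf w)); apply: eq_bigr => i _; rewrite cobasisE. Qed.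

Lemma forms_sep W (w : W) : (forall g : 'Hom(W, k^o), g w = 0) -> w = 0.
Proof.
by move=> w0; rewrite (cobasis_sum w) big1 // => i _; rewrite w0 scale0r.
Qed.

Definition eval_at U V (x : U) : 'Hom('Hom(U, V), V) :=
  linfun (fun f : 'Hom(U, V) => f x).

Lemma eval_atE U V (x : U) (f : 'Hom(U, V)) : eval_at V x f = f x.
Proof. by apply: linfun_linE => c y z; rewrite add_lfunE scale_lfunE. Qed.

Lemma eval_sep U V (f : 'Hom(U, V)) : (forall x, eval_at V x f = 0) -> f = 0.
Proof. by move=> f0; apply/lfunP => x; rewrite -eval_atE f0 lfunE. Qed.

(** Contracting the second leg with a functional of [Q j] gives a vector of U that every [P i]
    kills. Hence contracting the first leg with any functional gives a vector of V that every [Q j]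
    kills, and so all matrix entries of t vanish. Only the families have to separate points, not
    their single members. *)
Lemma tens_sep U V U' V' (I J : Type) (P : I -> 'Hom(U, U')) (Q : J -> 'Hom(V, V')) :
  (forall u, (forall i, P i u = 0) -> u = 0) ->
  (forall v, (forall j, Q j v = 0) -> v = 0) ->
  forall t, (forall i j, tmap (P i) (Q j) t = 0) -> t = 0.
Proof.
move=> sP sQ t t0.
have fst0 j (q : 'Hom(V', k^o)) :
    tlift (fun u v => (q (Q j v) : k) *: u) t = 0.
  apply: sP => i; apply: forms_sep => l.
  rewrite (map_tlift (L := fun u => l (P i u))); last by lin.
  have : tlift (fun x y => (q y : k) *: (l x : k^o)) (tmap (P i) (Q j) t) = 0.
    by rewrite t0 linear0.
  rewrite tlift_tmap; last by lin.
  by move=> <-; apply: eq_tlift => u v; rewrite !linearZ.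
have snd0 (p : 'Hom(U, k^o)) : tlift (fun u v => (p u : k) *: v) t = 0.
  apply: sQ => j; apply: forms_sep => l.
  rewrite (map_tlift (L := fun u => l (Q j u))); last by lin.
  have := congr1 p (fst0 j (l)); rewrite linear0 => <-.
  rewrite (map_tlift (L := p)); last by lin.
  by apply: eq_tlift => u v; rewrite !linearZ; apply: mulrC.
apply/matrixP => i j; rewrite -tens_coord [RHS]mxE.
under eq_tlift => u v do rewrite -cobasisE.
by rewrite snd0 linear0.
Qed.

Lemma tlift_assoc U V W (X : vectType k) (F : U -> V -> W -> X) s : trilin F ->
  tlift (fun a t => tlift (F a) t) (tassoc U V W s) =
  tlift (fun t w => tlift (fun u v => F u v w) t) s.
Proof.
move=> [F1 F2 F3]; rewrite /tassoc tlift_comp; apply: eq_tlift => t w.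
rewrite (map_tlift (L := tlift _)); last by lin.
apply: eq_tlift => u v; by rewrite !tlift_tens //; lin.
Qed.

Lemma tassoc_nat U V W U' V' W' (f : 'Hom(U, U')) (g : 'Hom(V, V')) (h : 'Hom(W, W')) t :
  tmap f (tmap g h) (tassoc _ _ _ t) = tassoc _ _ _ (tmap (tmap f g) h t).
Proof.
move: t; apply: tens_ind; [by lin|by lin|] => t w; rewrite tmap_tens; move: t.
apply: tens_ind; [by lin|by lin|] => u v.
by rewrite !(tassoc_tens, tmap_tens).
Qed.

Lemma tswap_nat U V U' V' (f : 'Hom(V, V')) (g : 'Hom(U, U')) (t : tensor U V) :
  tmap f g (tswap _ _ t) = tswap _ _ (tmap g f t).
Proof.
move: t; apply: tens_ind; [by lin|by lin|] => u v.
by rewrite !(tswap_tens, tmap_tens).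
Qed.

Lemma lfun_injK U V (f : 'Hom(U, V)) : injective f -> cancel f f^-1%VF.
Proof. by move=> fi; apply: lker0_lfunK; apply/lker0P. Qed.

(** By finite dimension an injective endomorphism is onto, so its generalised inverse is
    two-sided. *)
Lemma lfun_injVK U (f : 'End(U)) : injective f -> cancel f^-1%VF f.
Proof. by move=> fi; apply: lker0_lfunVK; apply/lker0P. Qed.

Lemma inv_lfun1 U : (\1^-1)%VF = \1%VF :> 'End(U).
Proof.
have i1 : injective (\1%VF : 'End(U)) by move=> x y; rewrite !id_lfunE.
by apply/lfunP => x; rewrite -{1}[x](id_lfunE x) lfun_injK // id_lfunE.
Qed.

Lemma tmap_id U V : tmap \1%VF \1%VF = \1%VF :> 'End(tensor U V).
Proof. by apply: tens_ext => u v; rewrite tmap_tens !id_lfunE. Qed.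

End TensorMore.

Ltac under_tlift tac := first
  [ tac; first [ reflexivity | solve [lin] ]
  | eapply eq_tlift; intros ? ?; cbv beta; under_tlift tac ].
(* deep rewrites the left-hand side at the first possible place, also below the
   binders of sw; deepn does so below exactly n of them. *)
Tactic Notation "deep" tactic3(tac) :=
  etransitivity; [ under_tlift tac | cbv beta ].
Tactic Notation "deepn" int_or_var(n) tactic3(tac) :=
  etransitivity;
  [ do n (eapply eq_tlift; intros ? ?; cbv beta); tac; first [ reflexivity | solve [lin] ]
  | cbv beta ].

(* Solves l = ?G u by abstracting u in l; this finds the context in which an
   antipode axiom is applied. *)
Ltac abstract_arg :=
  intros; match goal with |- ?l = ?G ?u =>
    let l' := eval pattern u in l in
    match l' with ?g _ => unify G g; reflexivity end end.

(** * Ordinary Hopf algebras *)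

Section Ordinary.
Variables (k : fieldType) (H : vectType k) (D : hom_data H).
Hypotheses (hD : is_hom_bialgebra D) (twist1 : twist D = \1%VF).
Notation "a ** b" := (hmul D a b) (at level 40, left associativity).
Notation Δ := (comult D).
Notation ε := (counit D).
Notation "'𝟙'" := (hone D).
Implicit Types W : vectType k.

Let algD := bialg_alg hD.
Let coalgD := bialg_coalg hD.

Lemma twistV1 : (twist D)^-1%VF = \1%VF :> 'End(H).
Proof. by rewrite twist1 inv_lfun1. Qed.

Lemma mulA a b c : a ** (b ** c) = a ** b ** c.
Proof. by have := hmulA algD a b c; rewrite twist1 !id_lfunE. Qed.

Lemma mul_1r a : a ** 𝟙 = a.
Proof. by have := hmul1r algD a; rewrite twist1 !id_lfunE. Qed.

Lemma mul_1l a : 𝟙 ** a = a.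
Proof. by have := hmul1l algD a; rewrite twist1 !id_lfunE. Qed.

Lemma mulZr c a b : a ** (c *: b) = c *: (a ** b).
Proof. by rewrite (@linear_scaleE k H H (fun x => a ** x)) //; lin. Qed.

Lemma mul_0r a : a ** 0 = 0.
Proof. by rewrite (linear_0 (L := fun x => a ** x)) //; lin. Qed.

Lemma coassoc W (F : H -> H -> H -> W) x : trilin F ->
  (sw( a , b <- Δ x ) sw( a1 , a2 <- Δ a ) F a1 a2 b) =
  (sw( a , b <- Δ x ) sw( b1 , b2 <- Δ b ) F a b1 b2).
Proof.
move=> tF; have [F1 F2 F3] := tF.
have := congr1 (tlift (fun a t => tlift (F a) t)) (comultA coalgD x).
rewrite tlift_assoc // twistV1 !tlift_tmap; first last.
- by lin; apply: F1.
- by lin; apply: F3.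
by move=> e; symmetry; move: e;
  under eq_tlift => u v do rewrite id_lfunE; under [RHS]eq_tlift => u v do rewrite id_lfunE.
Qed.

Lemma sw_counitl W (F : H -> W) x : linear F ->
  (sw( a , b <- Δ x ) (ε a : k) *: F b) = F x.
Proof.
move=> lF; have := congr1 F (counitl coalgD x).
rewrite map_tlift // twistV1 id_lfunE => <-.
by apply: eq_tlift => a b; rewrite linear_scaleE.
Qed.

Lemma sw_counitr W (F : H -> W) x : linear F ->
  (sw( a , b <- Δ x ) (ε b : k) *: F a) = F x.
Proof.
move=> lF; have := congr1 F (counitr coalgD x).
rewrite map_tlift // twistV1 id_lfunE => <-.
by apply: eq_tlift => a b; rewrite linear_scaleE.
Qed.

Lemma sw_mul W (F : H -> H -> W) a b : bilin F ->
  tlift F (Δ (a ** b)) =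
  (sw( a1 , a2 <- Δ a ) sw( b1 , b2 <- Δ b ) F (a1 ** b1) (a2 ** b2)).
Proof.
move=> bF; rewrite (comultM hD) /tmul tlift_comp; apply: eq_tlift => a1 a2.
by rewrite tlift_comp; apply: eq_tlift => b1 b2; rewrite tlift_tens.
Qed.

Lemma sw_one W (F : H -> H -> W) : bilin F -> tlift F (Δ 𝟙) = F 𝟙 𝟙.
Proof. by move=> bF; rewrite (comult1 hD) tlift_tens. Qed.

(** * The antipode reverses products and coproducts *)

Section Antipode.
Variable S : 'End(H).
Hypothesis hS : is_antipode D S.

(** The map [G] is the context in which S(a) b occurs; this lets the axiom act inside a longer
    product. In most uses [abstract_arg] finds it. *)
Lemma sw_antipodel W (F : H -> H -> W) (G : H -> W) x :
  (forall a b, F a b = G (S a ** b)) -> linear G ->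
  tlift F (Δ x) = (ε x : k) *: G 𝟙.
Proof.
move=> FG lG; have := congr1 G (antipodel hS x).
by rewrite map_tlift // linear_scaleE // => <-; apply: eq_tlift.
Qed.

Lemma sw_antipoder W (F : H -> H -> W) (G : H -> W) x :
  (forall a b, F a b = G (a ** S b)) -> linear G ->
  tlift F (Δ x) = (ε x : k) *: G 𝟙.
Proof.
move=> FG lG; have := congr1 G (antipoder hS x).
by rewrite map_tlift // linear_scaleE // => <-; apply: eq_tlift.
Qed.

Lemma antipode1 : S 𝟙 = 𝟙.
Proof.
have := antipodel hS 𝟙; rewrite sw_one; last by lin.
by rewrite mul_1r (counit1 hD) scale1r.
Qed.

Lemma counit_antipode x : ε (S x) = ε x.
Proof.
transitivity (tlift (fun a b => (ε (S a) : k) *: ε b) (Δ x)).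
  rewrite -[LHS](sw_counitr (F := fun a => ε (S a)) x); last by lin.
  by apply: eq_tlift => a b; apply: mulrC.
have := congr1 ε (antipodel hS x); rewrite (map_tlift (L := ε)); last by lin.
rewrite linearZ /= (counit1 hD) [_ *: 1]mulr1 => <-.
by apply: eq_tlift => a b; rewrite (counitM hD).
Qed.

(** Uniqueness of convolution inverses: both sides invert the multiplication H \ox H -> H. The
    intermediate term is S(x1 y1) x2 y2 S(y3) S(x3). *)
Lemma antipodeM x y : S (x ** y) = S y ** S x.
Proof.
transitivity (sw( x1 , x2 <- Δ x ) sw( y1 , y2 <- Δ y ) sw( p , q <- Δ (x1 ** y1) )
   S p ** q ** (S y2 ** S x2)); last first.
  deep (eapply sw_antipodel; [abstract_arg|lin]).
  deep (rewrite (counitM hD) mulrC -scalerA).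
  do 2 deep (rewrite sw_counitl).
  by rewrite mul_1l.
(* Grouped the other way, y2 S(y3) cancels first and then x2 S(x3), which leaves S(x y). *)
symmetry; deep (rewrite sw_mul).
deepn 1 (rewrite tlift_exch).
rewrite coassoc; last by lin.
deepn 2 (rewrite coassoc).
deepn 4 (rewrite -!mulA [X in _ ** (_ ** X)]mulA).
deep (eapply sw_antipoder; [abstract_arg|lin]).
deep (rewrite sw_counitr).
deep (rewrite mul_1l).
deep (eapply sw_antipoder; [abstract_arg|lin]).
by rewrite sw_counitr ?mul_1r //; lin.
Qed.

(* Both sides are convolution inverse to [Δ \o S]. *)
Lemma sw_antipode W (F : H -> H -> W) x : bilin F ->
  tlift F (Δ (S x)) = sw( a , b <- Δ x ) F (S b) (S a).
Proof.
move=> bF; have [F1 F2] := bF.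
(* The product of Δ(S(x1)), Δ(x2) and S(x4) \ox S(x3): the last two factors cancel to give the left
   side, the first two to give the right side. *)
transitivity (sw( x1 , x2 <- Δ x ) sw( p , q <- Δ (S x1) )
  sw( x3 , x4 <- Δ x2 ) sw( x5 , x6 <- Δ x3 ) sw( x7 , x8 <- Δ x4 )
  F (p ** (x5 ** S x8)) (q ** (x6 ** S x7))).
  symmetry; deepn 2 (rewrite coassoc).
  deepn 3 (rewrite -coassoc).
  deepn 4 (eapply sw_antipoder; [abstract_arg|lin]).
  deep (rewrite sw_counitl).
  deepn 2 (eapply sw_antipoder; [abstract_arg|lin]).
  deepn 1 (rewrite tliftZ).
  rewrite sw_counitr; last by lin.
  by apply: eq_tlift => p q; rewrite !mul_1r.
deepn 1 (rewrite tlift_exch).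
rewrite -coassoc; last by lin.
transitivity (sw( a , b <- Δ x ) sw( a1 , a2 <- Δ a )
   sw( p , q <- Δ (S a1 ** a2) ) sw( x7 , x8 <- Δ b ) F (p ** S x8) (q ** S x7)).
  apply: eq_tlift => a b; apply: eq_tlift => a1 a2.
  rewrite sw_mul; last by lin.
  by apply: eq_tlift => p q; apply: eq_tlift => u v; apply: eq_tlift => y z; rewrite !mulA.
deep (eapply sw_antipodel; [abstract_arg|lin]).
rewrite sw_counitl; last by lin.
rewrite sw_one; last by lin.
by apply: eq_tlift => p q; rewrite !mul_1l.
Qed.

(** * Integrals and bijectivity of the antipode *)

Section Integrals.
Notation Hd := 'Hom(H, k^o).
Notation "f · g" := (hmul (dual_data D) f g) (at level 40).
Notation "'e[' i ]" := (vbasis {:H})`_i.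
Notation "'f[' i ]" := (cobasis i : Hd).

Lemma dual_mulA (f g m : Hd) : f · (g · m) = f · g · m.
Proof.
apply/lfunP => x; rewrite !dual_mulE.
transitivity (sw( a , b <- Δ x ) sw( b1 , b2 <- Δ b ) (f a * g b1 * m b2 : k^o)).
  apply: eq_tlift => a b; rewrite dual_mulE (map_tlift (L := fun u : k^o => ((f a : k) * (u : k) : k^o))).
    by apply: eq_tlift => c d; rewrite mulrA.
  by lin.
rewrite -(coassoc (F := fun a b c => (f a * g b * m c : k^o))); last by lin.
apply: eq_tlift => a b; rewrite dual_mulE (map_tlift (L := fun u : k^o => ((u : k) * (m b : k) : k^o))) //.
by lin.
Qed.

Lemma cobasis_eval W (F : H -> W) x : linear F -> \sum_i (f[i] x : k) *: F e[i] = F x.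
Proof. by move=> lF; rewrite {2}(cobasis_sum x) linear_sumE. Qed.

(* [\sum_l f[l] \ox Δ e[l]] is the product of two copies of [\sum_i f[i] \ox e[i]]. *)
Lemma canonical_comult W (F : Hd -> H -> H -> W) : trilin F ->
  \sum_l (sw( a , b <- Δ e[l] ) F f[l] a b) = \sum_i \sum_j F (f[i] · f[j]) e[i] e[j].
Proof.
move=> [F1 F2 F3].
under eq_bigr => l _ do rewrite tliftE /tlift_fun.
rewrite exchange_big; apply: eq_bigr => i _; rewrite exchange_big; apply: eq_bigr => j _.
rewrite -(linear_sumE _ _ (F1 _ _)); congr (F _ _ _); apply/lfunP => x.
rewrite sum_lfunE dual_mulE.
under eq_bigr => l _ do rewrite scale_lfunE.
transitivity ((Δ x : 'M[k]_(_, _)) i j).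
  rewrite -(cobasis_eval (W := k^o) (F := fun x => (Δ x : 'M[k]_(_, _)) i j)).
    by apply: eq_bigr => l _; apply: mulrC.
  by move=> c y z; rewrite linearP !mxE.
rewrite -tens_coord -cobasisE (map_tlift (L := cobasis j)); last by lin.
by apply: eq_tlift => u v; rewrite -cobasisE linearZ.
Qed.

(** In the algebra [H^*] this reads g l = g(1) l, where g(1) is the counit of g: l is a left
    integral in [H^*]. *)
Definition left_integral (l : Hd) : Prop :=
  forall (g : Hd) x, (sw( a , b <- Δ x ) (g a * l b : k^o)) = (g 𝟙 : k) * (l x : k).

(* H^* is a right Hopf module for the action (m.h)(x) = m(x S(h)). *)
Lemma hopf_module_identity (f g : Hd) x h :
  (sw( h1 , h2 <- Δ h ) sw( a , b <- Δ (x ** S h1) ) (g (a ** h2) * f b : k^o)) =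
  sw( a , b <- Δ x ) (g a * f (b ** S h) : k^o).
Proof.
deep (rewrite sw_mul).
deep (rewrite sw_antipode).
rewrite tlift_exch.
deepn 1 (rewrite coassoc).
deepn 3 (rewrite -mulA).
deepn 2 (eapply sw_antipodel; [abstract_arg|lin]).
deepn 1 (rewrite sw_counitr).
by apply: eq_tlift => a b; rewrite mul_1r.
Qed.

(* The projection m |-> m_0.S(m_1) onto the coinvariants of this Hopf module. *)
Definition integral_of (m : Hd) : Hd :=
  linfun (fun x => \sum_i ((f[i] · m) (x ** S (S e[i])) : k^o)).

Lemma integral_ofE m x : integral_of m x = \sum_i ((f[i] · m) (x ** S (S e[i])) : k^o).
Proof. by apply: linfun_linE; lin. Qed.

(** The Hopf module identity, applied with h = S(e_i), moves S(S(e_i)) from the second leg into the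
    argument of the coproduct and puts a factor S(c1) next to a. [canonical_comult] then splits the
    basis sum in two; the sum over i replaces e_i by p, and a S(p) cancels, which leaves the scalar
    g(1). *)
Lemma integral_of_left m : left_integral (integral_of m).
Proof.
move=> g x.
transitivity (\sum_i (sw( a , b <- Δ x ) (g a * (f[i] · m) (b ** S (S e[i])) : k^o))).
  transitivity (sw( a , b <- Δ x ) \sum_i (g a * (f[i] · m) (b ** S (S e[i])) : k^o)).
    by apply: eq_tlift => a b; rewrite integral_ofE mulr_sumr.
  by rewrite tlift_sum.
pose Φ (f : Hd) c1 c2 : k^o := sw( a , b <- Δ (x ** S (S c2)) ) sw( b1 , b2 <- Δ b )
  (f b1 * (g (a ** S c1) * m b2) : k^o).
transitivity (\sum_i (sw( c1 , c2 <- Δ e[i] ) Φ f[i] c1 c2)).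
  apply: eq_bigr => i _; rewrite -hopf_module_identity sw_antipode; last by lin.
  apply: eq_tlift => c1 c2; apply: eq_tlift => a b.
  rewrite dual_mulE (map_tlift (L := fun u : k^o => ((g (a ** S c1) : k) * (u : k) : k^o))); last by lin.
  by apply: eq_tlift => b1 b2; rewrite mulrCA.
rewrite canonical_comult; last by rewrite /Φ; lin.
rewrite exchange_big integral_ofE mulr_sumr; apply: eq_bigr => j _; rewrite /Φ.
rewrite dual_mulE.
transitivity (sw( a , b <- Δ (x ** S (S e[j]))) sw( b1 , b2 <- Δ b ) 
  sw( p , q <- Δ b1 ) ((g (a ** S p) * f[j] q * m b2) : k^o)).
  symmetry.
  deepn 3 (rewrite -(cobasis_eval (W := k^o) (F := fun y => (g (_ ** S y) * _ * _ : k^o)))).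
  deepn 2 (rewrite tlift_sum).
  deepn 1 (rewrite tlift_sum).
  rewrite tlift_sum; apply: eq_bigr => i _.
  apply: eq_tlift => a b; apply: eq_tlift => b1 b2.
  rewrite dual_mulE (map_tlift (L := fun u : k^o => ((u : k) * (g (a ** S e[i]) * m b2 : k) : k^o))); last by lin.
  apply: eq_tlift => p q; rewrite -[LHS]/(_ * _) -!mulrA; congr (_ * _).
  exact: mulrCA.
deepn 1 (rewrite coassoc).
rewrite -coassoc; last by lin.
deep (eapply sw_antipoder; [abstract_arg|lin]).
rewrite sw_counitl; last by lin.
rewrite (map_tlift (L := fun u : k^o => ((g 𝟙 : k) * (u : k) : k^o))); last by lin.
by apply: eq_tlift => a b; rewrite mulrA.
Qed.

(** Fundamental theorem of Hopf modules: m is the sum of P(m_0).m_1, where P is the projection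
    [integral_of]. If P vanished on all f_i m, then m would be zero. The reason is that S(m_1) m_2
    cancels. *)
Lemma integral_recovers m x :
  \sum_i (integral_of (f[i] · m) (x ** S e[i]) : k^o) = m x.
Proof.
pose Φ (f : Hd) c1 c2 : k^o := (f · m) (x ** S (S c1 ** c2)).
transitivity (\sum_i (sw( c1 , c2 <- Δ e[i] ) Φ f[i] c1 c2)).
  rewrite canonical_comult; last by rewrite /Φ; lin.
  rewrite exchange_big; apply: eq_bigr => i _; rewrite integral_ofE.
  by apply: eq_bigr => j _; rewrite /Φ dual_mulA antipodeM mulA.
transitivity (\sum_i ((f[i] · m) x * ε e[i] : k^o)).
  apply: eq_bigr => i _.
  rewrite (sw_antipodel (G := fun u => (f[i] · m) (x ** S u))) //; last by lin.
  by rewrite antipode1 mul_1r; apply: mulrC.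
transitivity (sw( a , b <- Δ x ) \sum_i (f[i] a : k) *: ((ε e[i] : k) * (m b : k) : k^o)).
  rewrite tlift_sum; apply: eq_bigr => i _.
  rewrite dual_mulE (map_tlift (L := fun u : k^o => ((u : k) * ε e[i] : k^o))); last by lin.
  by apply: eq_tlift => a b; rewrite -[RHS]/(_ * _) mulrAC mulrA.
rewrite -[RHS](sw_counitl (F := m)); last by lin.
apply: eq_tlift => a b.
by rewrite (@cobasis_eval k^o (fun y => (ε y * m b : k^o))) //; lin.
Qed.

Lemma left_integral_exists : (exists x : H, x != 0) -> exists2 l, l != 0 & left_integral l.
Proof.
move=> [x x0].
have [m mx] : exists m : Hd, m x != 0.
  have [/forallP f0|/forallPn[i]] := boolP [forall i, f[i] x == 0].
    by case/eqP: x0; rewrite (cobasis_sum x) big1 // => i _; rewrite (eqP (f0 i)) scale0r.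
  by exists f[i].
have [/forallP f0|/forallPn[i l0]] := boolP [forall i, integral_of (f[i] · m) == 0].
  case/eqP: mx; rewrite -integral_recovers big1 // => i _.
  by rewrite (eqP (f0 i)) lfunE.
by exists (integral_of (f[i] · m)) => //; apply: integral_of_left.
Qed.

(** The functionals l(? S(h1)) tensored with h2 sum to zero: paired with x and g, this sum turns by
    the integral property into the left side of the Hopf module identity, whose right side contains
    S(h). A suitable linear map then extracts l(x) h from it. *)
Lemma left_integral_faithful (l : Hd) h : l != 0 -> left_integral l -> S h = 0 -> h = 0.
Proof.
move=> l0 intl Sh.
pose Λ : 'Hom(H, Hd) := linfun (fun y => linfun (fun x => (l (x ** y) : k^o))).
have ΛE y x : Λ y x = l (x ** y).
  rewrite linfun_linE; first by rewrite linfun_linE //; lin.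
  move=> c u v; apply/lfunP => z; rewrite add_lfunE scale_lfunE !linfun_linE; lin.
  by case: (hmul_bilin D) => _ ->; rewrite linearP.
have τ0 : (sw( a , b <- Δ h ) Λ (S a) \ox b) = 0.
  apply: (tens_sep (P := fun x : H => eval_at k^o x) (Q := fun g : Hd => g)).
  - exact: eval_sep.
  - exact: forms_sep.
  move=> x g.
  rewrite (map_tlift (L := tmap _ _)); last by lin.
  deep (rewrite tmap_tens eval_atE ΛE).
  deep (rewrite tens_scalar).
  rewrite -(map_tlift (L := fun c : k^o => (c : k) *: ((1 : k^o) \ox (1 : k^o)))); last by lin.
  rewrite [tlift _ _](_ : _ = 0) ?scale0r //.
  transitivity (sw( a , b <- Δ x ) (g a * l (b ** S h) : k^o)); last first.
    by rewrite Sh tliftE /tlift_fun big1 // => i _; rewrite big1 // => j _;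
      rewrite mul_0r linear0 mulr0 scaler0.
  rewrite -hopf_module_identity; apply: eq_tlift => a b.
  (* The translate of g by b has value g(b) at 1, so the integral property for it trades g(b) for a
     coproduct. *)
  pose g' : Hd := linfun (fun y => (g (y ** b) : k^o)).
  have g'E y : g' y = g (y ** b) by apply: linfun_linE; lin.
  transitivity ((g' 𝟙 : k) * (l (x ** S a) : k)); first by rewrite g'E mul_1l mulrC.
  by rewrite -intl; apply: eq_tlift => u v; rewrite g'E.
have lh x : (l x : k) *: h = 0.
  (* Applied to the vanishing sum, [L] gives l(x S(S(h2)) S(h1)) h3. Here S(S(h2)) S(h1) is S(h1
     S(h2)), which cancels to 1 and leaves l(x) h. *)
  pose L (f : Hd) (y : H) : H := sw( y1 , y2 <- Δ y ) (f (x ** S (S y1)) : k) *: y2.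
  have := congr1 (tlift L) τ0; rewrite linear0 tlift_comp => <-; symmetry.
  deep (rewrite tlift_tens /L).
  deep (rewrite ΛE -mulA -antipodeM).
  rewrite -coassoc; last by lin.
  deep (eapply sw_antipoder; [abstract_arg|lin]).
  by rewrite sw_counitl ?antipode1 ?mul_1r //; lin.
apply/eqP; apply: contraT => h0; case/eqP: l0; apply/lfunP => x.
by have /eqP := lh x; rewrite scaler_eq0 (negPf h0) orbF lfunE => /eqP.
Qed.

Lemma antipode_inj : injective S.
Proof.
move=> x y Sxy; apply/eqP; rewrite -subr_eq0; apply/eqP.
have Sxy0 : S (x - y) = 0 by rewrite linearB /= Sxy subrr.
apply/eqP; apply: contraT => xy0.
have [|l l0 intl] := left_integral_exists; first by exists (x - y).
by case/eqP: xy0; exact: left_integral_faithful l0 intl Sxy0.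
Qed.
End Integrals.

Notation Sb := (S^-1)%VF.

Lemma antipodeK : cancel S Sb. Proof. exact: lfun_injK antipode_inj. Qed.
Lemma antipodeVK : cancel Sb S. Proof. exact: lfun_injVK antipode_inj. Qed.

Lemma antipodeVM x y : Sb (x ** y) = Sb y ** Sb x.
Proof. by apply: antipode_inj; rewrite antipodeM !antipodeVK. Qed.

Lemma antipodeV1 : Sb 𝟙 = 𝟙.
Proof. by rewrite -{1}antipode1 antipodeK. Qed.

Lemma counit_antipodeV x : ε (Sb x) = ε x.
Proof. by rewrite -{2}[x]antipodeVK counit_antipode. Qed.

Lemma sw_antipodeV W (F : H -> H -> W) x : bilin F ->
  tlift F (Δ (Sb x)) = sw( a , b <- Δ x ) F (Sb b) (Sb a).
Proof.
move=> bF; rewrite -{2}[x]antipodeVK sw_antipode; last by lin.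
by apply: eq_tlift => a b; rewrite !antipodeK.
Qed.

(** S^{-1} is an antipode for the opposite coproduct, hence the reversed order of the two legs. *)
Lemma sw_antipodeVl W (F : H -> H -> W) (G : H -> W) x :
  (forall a b, F a b = G (Sb b ** a)) -> linear G ->
  tlift F (Δ x) = (ε x : k) *: G 𝟙.
Proof.
move=> FG lG; rewrite (sw_antipodel (G := fun u => G (Sb u))); first by rewrite antipodeV1.
  by move=> a b; rewrite FG antipodeVM antipodeK.
by lin.
Qed.

Lemma sw_antipodeVr W (F : H -> H -> W) (G : H -> W) x :
  (forall a b, F a b = G (b ** Sb a)) -> linear G ->
  tlift F (Δ x) = (ε x : k) *: G 𝟙.
Proof.
move=> FG lG; rewrite (sw_antipoder (G := fun u => G (Sb u))); first by rewrite antipodeV1.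
  by move=> a b; rewrite FG antipodeVM antipodeK.
by lin.
Qed.

(** * The Drinfel'd double of an ordinary Hopf algebra *)

(* Identify h \ox f with the endomorphism a |-> f(a) h. The product of the double
   becomes (XY)(a) = y_2 X(S(y_1) a_1 y_3) with y = Y(a_2), which is Ad below for
   F u b = u X(b), z = Y(a_2) and a = a_1. *)
Definition Ad W (F : H -> H -> W) (z a : H) : W :=
  sw( z1 , z' <- Δ z ) sw( z2 , z3 <- Δ z' ) F z2 (S z1 ** a ** z3).

Lemma Ad_bilin W (F : H -> H -> W) : bilin F -> bilin (Ad F).
Proof. by move=> bF; rewrite /Ad; lin. Qed.

Lemma Ad_lin (X : lmodType k) W (F : X -> H -> H -> W) z a :
  (forall u b, linear (fun x => F x u b)) -> linear (fun x => Ad (F x) z a).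
Proof. by move=> lF; rewrite /Ad; lin. Qed.

Lemma eq_Ad W (F G : H -> H -> W) z a : F =2 G -> Ad F z a = Ad G z a.
Proof. by move=> FG; rewrite /Ad; apply: eq_tlift => ? ?; apply: eq_tlift => ? ?; apply: FG. Qed.

Lemma map_Ad W W' (L : W -> W') (F : H -> H -> W) z a : linear L ->
  L (Ad F z a) = Ad (fun u b => L (F u b)) z a.
Proof. by move=> lL; rewrite /Ad map_tlift //; apply: eq_tlift => ? ?; rewrite map_tlift. Qed.

(** Since S reverses products, S(x1 y1) a x3 y3 is S(y1) (S(x1) a x3) y3: the action of x y is that
    of x followed by that of y. *)
Lemma Ad_mul W (F : H -> H -> W) x y a : bilin F ->
  Ad F (x ** y) a = Ad (fun u b => Ad (fun v c => F (u ** v) c) y b) x a.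
Proof.
move=> bF; rewrite /Ad sw_mul; last by lin.
deepn 2 (rewrite sw_mul).
deepn 1 (rewrite tlift_exch).
apply: eq_tlift => x1 x'; apply: eq_tlift => x2 x3; apply: eq_tlift => y1 y'.
by apply: eq_tlift => y2 y3; rewrite antipodeM !mulA.
Qed.

Lemma Ad_one W (F : H -> H -> W) a : bilin F -> Ad F 𝟙 a = F 𝟙 a.
Proof.
move=> bF; rewrite /Ad sw_one; last by lin.
by rewrite sw_one ?antipode1 ?mul_1r ?mul_1l //; lin.
Qed.

Lemma Ad_counit W (G : H -> W) z a : linear G ->
  Ad (fun u b => (ε b : k) *: G u) z a = (ε a : k) *: G z.
Proof.
move=> lG; rewrite /Ad.
deepn 2 (rewrite !(counitM hD) counit_antipode mulrC -scalerA).
deepn 1 (rewrite sw_counitr).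
deepn 1 (rewrite -scalerA).
by rewrite sw_counitl //; lin.
Qed.

(** As S reverses coproducts, the legs of Δ(S(z1) a z3) are nested: with five factors of z they are
    S(z2) a1 z4 and S(z1) a2 z5, and z3 stays in the middle. *)
Lemma Ad_comult W (F : H -> H -> H -> W) z a : trilin F ->
  Ad (fun u b => tlift (F u) (Δ b)) z a =
  sw( a1 , a2 <- Δ a ) Ad (fun u b2 => Ad (fun v b1 => F v b1 b2) u a1) z a2.
Proof.
move=> tF; rewrite /Ad.
deepn 2 (rewrite sw_mul).
deepn 2 (rewrite sw_mul).
deepn 2 (rewrite sw_antipode).
deepn 2 (rewrite tlift_exch).
deepn 1 (rewrite tlift_exch).
rewrite tlift_exch; apply: eq_tlift => a1 a2.
deepn 1 (rewrite tlift_exch).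
rewrite coassoc; last by lin.
symmetry.
deepn 1 (rewrite coassoc).
by deepn 2 (rewrite coassoc).
Qed.

(** The product of S(z1) x z3 and S(z4) y z6 loses its inner pair z3 S(z4). *)
Lemma Ad_comult2 W (F : H -> H -> H -> W) z x y : trilin F ->
  (sw( z' , z'' <- Δ z ) Ad (fun u b => Ad (fun v c => F u v (b ** c)) z'' y) z' x) =
  Ad (fun t b => sw( u , v <- Δ t ) F u v b) z (x ** y).
Proof.
move=> tF; rewrite /Ad.
rewrite coassoc; last by lin.
deepn 1 (rewrite coassoc).
deepn 2 (rewrite -coassoc).
deepn 3 (rewrite tlift_exch).
deepn 5 (rewrite !mulA -(mulA _ _ (S _))).
deepn 4 (eapply sw_antipoder; [abstract_arg|lin]).
deepn 3 (rewrite tliftZ).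
deepn 2 (rewrite sw_counitl).
symmetry; deepn 1 (rewrite coassoc).
do 3 (apply: eq_tlift => ? ?).
by rewrite mul_1r !mulA.
Qed.

Lemma twistD1 : twist (double_data D S) = \1%VF.
Proof.
rewrite /= twist1; apply: tens_ext => h f; rewrite tmap_tens !id_lfunE; congr (_ \ox _).
by apply/lfunP => a; rewrite dual_twistE twistV1 id_lfunE.
Qed.

(** * The bialgebra axioms of the double, checked on endomorphisms of H *)

Notation Hd := 'Hom(H, k^o).
Notation HH := (tensor H Hd).
Notation DD := (double_data D S).

Definition double_eval (a : H) : 'Hom(HH, H) := tlift (fun h (f : Hd) => (f a : k) *: h).
Notation "x @@ a" := (double_eval a x) (at level 35).

Lemma double_eval_tens h f a : (h \ox f) @@ a = (f a : k) *: h.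
Proof. by rewrite /double_eval tlift_tens //; lin. Qed.

Lemma lin_double_eval x : linear (fun a => x @@ a).
Proof. by rewrite /double_eval; lin. Qed.

Lemma double_eval_sep x : (forall a, x @@ a = 0) -> x = 0.
Proof.
move=> x0; apply: (tens_sep (P := fun _ : unit => \1%VF : 'End(H)) (Q := fun a : H => eval_at k^o a)).
- by move=> u /(_ tt); rewrite id_lfunE.
- exact: eval_sep.
move=> _ a; have := congr1 (fun u => u \ox (1 : k^o)) (x0 a).
rewrite (linear_0 (L := fun u => u \ox (1 : k^o))); last by lin.
rewrite /double_eval (map_tlift (L := fun u => u \ox (1 : k^o))); last by lin.
move=> <-; apply: eq_tlift => h f; rewrite id_lfunE eval_atE.
by rewrite -[f a in LHS]mulr1 (linear_scaleE (L := fun u : k^o => _ \ox u))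
  ?(linear_scaleE (L := fun u => u \ox (1 : k^o))) //; lin.
Qed.

Lemma double_eval_ext x y : (forall a, x @@ a = y @@ a) -> x = y.
Proof.
move=> xy; apply/eqP; rewrite -subr_eq0; apply/eqP/double_eval_sep => a.
by rewrite linearB /= xy subrr.
Qed.

Lemma double_evalM x y a :
  hmul DD x y @@ a = sw( a1 , a2 <- Δ a ) Ad (fun u b => u ** (x @@ b)) (y @@ a2) a1.
Proof.
move: x; apply: tens_ind; [by lin| by lin; apply: Ad_lin; lin|] => h f.
move: y; apply: tens_ind; [by lin| by lin; apply: Ad_bilin; lin|] => l g.
rewrite double_mulE /double_mul4.
transitivity (sw( l1 , l' <- Δ l ) sw( l2 , l3 <- Δ l' ) sw( a1 , a2 <- Δ a )
  (g a2 : k) *: ((f (S l1 ** a1 ** l3) : k) *: (l2 ** h))).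
  rewrite (map_tlift (L := fun x => x @@ a)); last by lin.
  apply: eq_tlift => l1 l'.
  rewrite (map_tlift (L := fun x => x @@ a)); last by lin.
  apply: eq_tlift => l2 l3.
  rewrite double_eval_tens dual_mulE twist1 !id_lfunE.
  rewrite (map_tlift (L := fun c : k^o => (c : k) *: (l2 ** h))); last by lin.
  apply: eq_tlift => a1 a2.
  by rewrite double_actE twistV1 !id_lfunE mulA scalerA mulrC.
deepn 1 (rewrite tlift_exch).
rewrite tlift_exch; apply: eq_tlift => a1 a2.
rewrite double_eval_tens.
rewrite (linear_scaleE (L := fun z => Ad _ z a1)); last first.
  by have [bl _] := @Ad_bilin H (fun u b => u ** ((h \ox f) @@ b)) ltac:(lin); apply: bl.
rewrite /Ad -tliftZ; apply: eq_tlift => l1 l'; rewrite -tliftZ; apply: eq_tlift => l2 l3.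
by rewrite double_eval_tens mulZr.
Qed.

Lemma dual_comult_eval (f : Hd) p q :
  tlift (fun f1 f2 : Hd => (f1 p * f2 q : k^o)) (comult (dual_data D) f) = f (p ** q).
Proof.
rewrite -dual_comultP -[RHS]eval_atE /tpair (map_tlift (L := eval_at k^o (p \ox q))); last by lin.
by apply: eq_tlift => f1 f2; rewrite eval_atE tlift_tens //; apply: mul_bilin.
Qed.

(** The coproduct of [H^*] is dual to the product of H, so evaluating its legs at a and b amounts to
    evaluating at a b. *)
Lemma double_eval_comult x a b :
  tmap (double_eval a) (double_eval b) (comult DD x) = Δ (x @@ (a ** b)).
Proof.
move: x; apply: tens_ind; [by lin|by lin|] => h f.
rewrite double_comultE double_eval_tens linearZ /= -[in RHS](tens_gen (Δ h)).
rewrite (map_tlift (L := tmap _ _)); last by lin.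
rewrite -tliftZ; apply: eq_tlift => h1 h2.
rewrite (map_tlift (L := tmap _ _)); last by lin.
rewrite -dual_comult_eval (map_tlift (L := fun c : k^o => (c : k) *: (h1 \ox h2))); last by lin.
apply: eq_tlift => f1 f2; rewrite tmap_tens !double_eval_tens.
rewrite (linear_scaleE (L := fun u => u \ox _)); last by lin.
by rewrite (linear_scaleE (L := fun u => _ \ox u)) ?scalerA //; lin.
Qed.

Lemma tlift_double_comult W (F : H -> H -> W) x a b : bilin F ->
  (sw( x1 , x2 <- comult DD x ) F (x1 @@ a) (x2 @@ b)) = tlift F (Δ (x @@ (a ** b))).
Proof. by move=> bF; rewrite -double_eval_comult tlift_tmap. Qed.

Lemma double_counitE x : counit DD x = ε (x @@ 𝟙).
Proof.
move: x; apply: tens_ind; [by lin|by lin|] => h f.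
rewrite double_eval_tens linearZ /= tlift_tens; first exact: mulrC.
by lin.
Qed.

Lemma double_one_eval a : hone DD @@ a = (ε a : k) *: 𝟙.
Proof. by rewrite double_eval_tens. Qed.

Lemma mul_eval_bilin x : bilin (fun u b => u ** (x @@ b)).
Proof. by have := lin_double_eval x; lin. Qed.

Lemma Ad_eval_bilin x : bilin (Ad (fun u b => u ** (x @@ b))).
Proof. exact/Ad_bilin/mul_eval_bilin. Qed.

Lemma double_mul1r x : hmul DD x (hone DD) = x.
Proof.
apply: double_eval_ext => a; rewrite double_evalM.
rewrite -[RHS](sw_counitr (F := fun a => x @@ a)); last exact: lin_double_eval.
apply: eq_tlift => a1 a2; rewrite double_one_eval.
have [bl _] := Ad_eval_bilin x.
rewrite (linear_scaleE (L := fun z => Ad _ z a1)) // Ad_one ?mul_1l //.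
exact: mul_eval_bilin.
Qed.

Lemma double_mul1l x : hmul DD (hone DD) x = x.
Proof.
apply: double_eval_ext => a; rewrite double_evalM.
rewrite -[RHS](sw_counitl (F := fun a => x @@ a)); last exact: lin_double_eval.
apply: eq_tlift => a1 a2.
transitivity (Ad (fun u b => (ε b : k) *: u) (x @@ a2) a1); last exact: (Ad_counit (G := id)).
apply: eq_Ad => u b.
by rewrite double_one_eval mulZr mul_1r.
Qed.

(** On the left, the value of y z is a product in H, and [Ad_mul] splits the action by it. On the
    right, x y is evaluated at a conjugated argument, whose coproduct [Ad_comult] distributes.
    Coassociativity at a makes the two forms agree. *)
Lemma double_mulA x y z : hmul DD x (hmul DD y z) = hmul DD (hmul DD x y) z.
Proof.
apply: double_eval_ext => a; rewrite [LHS]double_evalM [RHS]double_evalM.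
have [Adl Adr] := Ad_eval_bilin x; have Adb := Ad_eval_bilin x.
have ey := lin_double_eval y; have ez := lin_double_eval z; have ex := lin_double_eval x.
transitivity (sw( a1 , w <- Δ a ) sw( w1 , w2 <- Δ w )
  Ad (fun u b2 => Ad (fun v b1 => v ** Ad (fun t c => t ** (x @@ c)) (y @@ b2) b1) u a1) (z @@ w2) w1).
  apply: eq_tlift => a1 w; rewrite double_evalM.
  rewrite (map_tlift (L := fun t => Ad _ t a1)) //; apply: eq_tlift => w1 w2.
  rewrite (map_Ad (L := fun t => Ad _ t a1)) //; apply: eq_Ad => u b2.
  rewrite Ad_mul; last exact: mul_eval_bilin.
  apply: eq_Ad => v b1.
  rewrite (map_Ad (L := fun t => v ** t)); last by lin.
  by apply: eq_Ad => t c; rewrite mulA.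
rewrite -(coassoc (F := fun a1 w1 w2 => Ad (fun u b2 =>
  Ad (fun v b1 => v ** Ad (fun t c => t ** (x @@ c)) (y @@ b2) b1) u a1) (z @@ w2) w1)); last first.
  by rewrite /Ad; lin.
apply: eq_tlift => a1 a2.
rewrite -(Ad_comult (F := fun v b1 b2 => v ** Ad (fun t c => t ** (x @@ c)) (y @@ b2) b1)); last first.
  by rewrite /Ad; lin.
apply: eq_Ad => u b; rewrite double_evalM (map_tlift (L := fun t => u ** t)) //; lin.
Qed.

Lemma double_eval_ext2 (s t : tensor HH HH) :
  (forall a b, tmap (double_eval a) (double_eval b) s = tmap (double_eval a) (double_eval b) t) ->
  s = t.
Proof.
move=> st; apply/eqP; rewrite -subr_eq0; apply/eqP.
apply: (tens_sep (P := double_eval) (Q := double_eval)); try exact: double_eval_sep.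
by move=> a b; rewrite linearB /= st subrr.
Qed.

Lemma double_eval_ext3 (s t : tensor HH (tensor HH HH)) :
  (forall a b c, tmap (double_eval a) (tmap (double_eval b) (double_eval c)) s =
                 tmap (double_eval a) (tmap (double_eval b) (double_eval c)) t) ->
  s = t.
Proof.
move=> st; apply/eqP; rewrite -subr_eq0; apply/eqP.
apply: (tens_sep (P := double_eval) (Q := fun bc : H * H => tmap (double_eval bc.1) (double_eval bc.2))).
- exact: double_eval_sep.
- move=> u u0; apply: double_eval_ext2 => a b; rewrite (u0 (a, b)).
  by rewrite linear0.
by move=> a [b c]; rewrite linearB /= st subrr.
Qed.

(** At a, b, c both sides become iterated coproducts in H of the value of x at the product a b c. *)
Lemma double_comultA x :
  tmap \1%VF (comult DD) (comult DD x) = tassoc _ _ _ (tmap (comult DD) \1%VF (comult DD x)).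
Proof.
apply: double_eval_ext3 => a b c.
rewrite [RHS]tassoc_nat.
rewrite [LHS]tmap_comp.
rewrite [in RHS]tmap_comp.
have coE p q : (tmap (double_eval p) (double_eval q) \o comult DD)%VF = (Δ \o double_eval (p ** q))%VF.
  by apply/lfunP => u; rewrite !comp_lfunE double_eval_comult.
have e1 p : (double_eval p \o \1)%VF = (\1 \o double_eval p)%VF.
  by rewrite comp_lfun1l comp_lfun1r.
rewrite !coE.
rewrite !e1.
rewrite -[LHS]tmap_comp.
rewrite -[in RHS]tmap_comp.
rewrite !double_eval_comult mulA.
by have := comultA coalgD (x @@ (a ** b ** c)); rewrite twistV1.
Qed.

Lemma double_counitr x : (sw( x1 , x2 <- comult DD x ) (counit DD x2 : k) *: x1) = x.
Proof.
apply: double_eval_ext => a; rewrite (map_tlift (L := fun x => x @@ a)); last by lin.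
rewrite -[a in RHS]mul_1r -[RHS](sw_counitr (F := id)) //.
rewrite -(tlift_double_comult (F := fun p q => (ε q : k) *: p)); last by lin.
by apply: eq_tlift => x1 x2; rewrite linearZ double_counitE.
Qed.

Lemma double_counitl x : (sw( x1 , x2 <- comult DD x ) (counit DD x1 : k) *: x2) = x.
Proof.
apply: double_eval_ext => a; rewrite (map_tlift (L := fun x => x @@ a)); last by lin.
rewrite -[a in RHS]mul_1l -[RHS](sw_counitl (F := id)) //.
rewrite -(tlift_double_comult (F := fun p q => (ε p : k) *: q)); last by lin.
by apply: eq_tlift => x1 x2; rewrite linearZ double_counitE.
Qed.

Lemma double_counitM x y :
  counit DD (hmul DD x y) = (counit DD x : k) * (counit DD y : k).
Proof.
have ex := lin_double_eval x.
rewrite !double_counitE double_evalM sw_one; last by rewrite /Ad; lin.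
rewrite (map_Ad (L := ε)) /Ad; last by lin.
deepn 2 (rewrite (counitM hD) mul_1r -[_ * _]/(_ *: _)).
deepn 1 (rewrite sw_counitl).
deep (eapply sw_antipodel; [abstract_arg|lin]).
exact: mulrC.
Qed.

Lemma double_counit1 : counit DD (hone DD) = 1.
Proof. by rewrite double_counitE double_one_eval linearZ /= !(counit1 hD) [_ *: 1]mulr1. Qed.

Lemma double_comult1 : comult DD (hone DD) = hone DD \ox hone DD.
Proof.
apply: double_eval_ext2 => a b; rewrite double_eval_comult tmap_tens !double_one_eval.
rewrite linearZ /= (comult1 hD) (counitM hD).
rewrite (linear_scaleE (L := fun u => u \ox _)); last by lin.
by rewrite (linear_scaleE (L := fun u => _ \ox u)) ?scalerA //; lin.
Qed.

(** The factors s and t enter the right side only through their evaluations, so coproducts and R can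
    be inserted in evaluated form. *)
Lemma double_evalM2 s t a b :
  tmap (double_eval a) (double_eval b) (hmul2 DD s t) =
  sw( a1 , a2 <- Δ a ) sw( b1 , b2 <- Δ b )
  sw( y , y' <- tmap (double_eval a2) (double_eval b2) t )
    Ad (fun u c => Ad (fun v d =>
      sw( p , q <- tmap (double_eval c) (double_eval d) s ) (u ** p) \ox (v ** q)) y' b1) y a1.
Proof.
have bm := hmul_bilin DD.
move: s; apply: tens_ind; first by rewrite /hmul2 /tmul; lin.
  by rewrite /Ad; lin.
move=> x x'; move: t; apply: tens_ind; first by rewrite /hmul2 /tmul; lin.
  by rewrite /Ad; lin.
move=> y y'; rewrite /hmul2 tmul_tens // tmap_tens !double_evalM.
rewrite (map_tlift (L := fun u => u \ox _)); last by lin.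
apply: eq_tlift => a1 a2.
rewrite (map_tlift (L := fun u => _ \ox u)); last by lin.
apply: eq_tlift => b1 b2; rewrite tmap_tens tlift_tens; last first.
  by rewrite /Ad; lin.
rewrite (map_Ad (L := fun u => u \ox _)); last by lin.
apply: eq_Ad => u c.
rewrite (map_Ad (L := fun u => _ \ox u)); last by lin.
apply: eq_Ad => v d; rewrite tmap_tens tlift_tens //.
by lin.
Qed.

(** On the right the legs of Δ(y(a2 b2)) act separately on a1 and b1; [Ad_comult2] fuses these into
    one action on a1 b1, which is what the left side contains. *)
Lemma double_comultM x y : comult DD (hmul DD x y) = hmul2 DD (comult DD x) (comult DD y).
Proof.
have ex := lin_double_eval x; have ey := lin_double_eval y.
apply: double_eval_ext2 => a b; rewrite double_eval_comult double_evalM2 double_evalM.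
rewrite sw_mul; last by rewrite /Ad; lin.
rewrite map_tlift; last by lin.
apply: eq_tlift => a1 a2; rewrite map_tlift; last by lin.
apply: eq_tlift => b1 b2; rewrite double_eval_comult (map_Ad (L := Δ)); last by lin.
pose F u v w := sw( p , q <- Δ (x @@ w) ) (u ** p) \ox (v ** q).
transitivity (Ad (fun t w => tlift (fun u v => F u v w) (Δ t)) (y @@ (a2 ** b2)) (a1 ** b1)).
  apply: eq_Ad => u w; rewrite -[LHS]tens_gen sw_mul //; exact: tens_bilin.
rewrite -Ad_comult2; last by rewrite /F; lin.
apply: eq_tlift => y1 y2; apply: eq_Ad => u c; apply: eq_Ad => v d.
by rewrite double_eval_comult.
Qed.

Lemma double_ordinary_bialgebra : is_hom_bialgebra DD.
Proof.
have tV : (twist DD)^-1%VF = \1%VF by rewrite twistD1 inv_lfun1.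
have bij1 : bijective (twist DD) by rewrite twistD1; exists id => x; rewrite id_lfunE.
split; last exact: double_counit1.
- split=> //.
  + by move=> a b c; rewrite twistD1 !id_lfunE double_mulA.
  + by move=> a; rewrite twistD1 id_lfunE double_mul1r.
  + by move=> a; rewrite twistD1 id_lfunE double_mul1l.
  + by move=> a b; rewrite twistD1 !id_lfunE.
  + by rewrite twistD1 id_lfunE.
- split=> //.
  + by move=> c; rewrite tV double_comultA.
  + by move=> c; rewrite tV id_lfunE double_counitr.
  + by move=> c; rewrite tV id_lfunE double_counitl.
  + by move=> c; rewrite twistD1 tmap_id !id_lfunE.
  + by move=> c; rewrite twistD1 id_lfunE.
- exact: double_comultM.
- exact: double_comult1.
- exact: double_counitM.
Qed.

(* The antipode sends h \ox f to the product of f \o S and S^{-1}(h) in the double. *)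
Definition double_antipode : 'End(HH) := tlift (fun h (f : Hd) =>
  sw( h1 , h' <- Δ h ) sw( h2 , h3 <- Δ h' )
    Sb h2 \ox linfun (fun a => (f (h1 ** S a ** S h3) : k^o))).

Lemma double_antipode_eval h (f : Hd) a :
  double_antipode (h \ox f) @@ a =
  sw( h1 , h' <- Δ h ) sw( h2 , h3 <- Δ h' ) (f (h1 ** S a ** S h3) : k) *: Sb h2.
Proof.
rewrite /double_antipode tlift_tens; last by lin.
rewrite (map_tlift (L := fun x => x @@ a)); last by lin.
apply: eq_tlift => h1 h'; rewrite (map_tlift (L := fun x => x @@ a)); last by lin.
by apply: eq_tlift => h2 h3; rewrite double_eval_tens linfun_linE //; lin.
Qed.

Lemma dual_comult_scale (f : Hd) p q W (v : W) :
  (f (p ** q) : k) *: v =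
  tlift (fun f1 f2 : Hd => ((f1 p : k) * (f2 q : k)) *: v) (comult (dual_data D) f).
Proof.
by rewrite -dual_comult_eval (map_tlift (L := fun c : k^o => (c : k) *: v)) //; lin.
Qed.

(** In Sweedler form the value at a is f(h1 S(h6) S(a1) S(S(h4)) S(h3) a2) h5 S^{-1}(h2). The pairs
    cancel from the inside: h3 with h4, h2 with h5, h1 with h6, and finally S(a1) a2. *)
Lemma double_antipodel x :
  (sw( x1 , x2 <- comult DD x ) hmul DD (double_antipode x1) x2) = (counit DD x : k) *: hone DD.
Proof.
move: x; apply: tens_ind; [by lin|by lin|] => h f.
apply: double_eval_ext => a.
rewrite double_counitE double_eval_tens [RHS](linear_scaleE (L := double_eval a)); last by lin.
rewrite [in RHS]double_one_eval.
transitivity (sw( h1 , h2 <- Δ h ) sw( a1 , a2 <- Δ a ) Ad (fun u b =>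
  sw( t1 , t' <- Δ h1 ) sw( t2 , t3 <- Δ t' ) (f (t1 ** S b ** S t3 ** a2) : k) *: (u ** Sb t2)) h2 a1).
  rewrite double_comultE [X in X @@ _]tlift_comp (map_tlift (L := fun x => x @@ a)); last by lin.
  apply: eq_tlift => h1 h2; rewrite [X in X @@ _]tlift_comp (map_tlift (L := fun x => x @@ a)); last by lin.
  rewrite /Ad; symmetry.
  (* The value of f at a product is split into f1 and f2, and this sum is moved outermost to meet
     the coproduct of h \ox f. *)
  deepn 5 (rewrite (dual_comult_scale f)).
  deepn 4 (rewrite tlift_exch).
  deepn 3 (rewrite tlift_exch).
  deepn 2 (rewrite tlift_exch).
  deepn 1 (rewrite tlift_exch).
  rewrite tlift_exch; apply: eq_tlift => f1 f2.
  rewrite tlift_tens; last by lin.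
  rewrite double_evalM; apply: eq_tlift => a1 a2.
  rewrite [in RHS]double_eval_tens.
  rewrite [RHS](linear_scaleE (L := fun z => Ad _ z a1)); last first.
    by have [bl _] := Ad_eval_bilin (double_antipode (h1 \ox f1)); apply: bl.
  rewrite /Ad -tliftZ; apply: eq_tlift => u1 u'; rewrite -tliftZ; apply: eq_tlift => u2 u3.
  rewrite double_antipode_eval (map_tlift (L := fun x => u2 ** x)); last by lin.
  rewrite -tliftZ; apply: eq_tlift => t1 t'.
  rewrite (map_tlift (L := fun x => u2 ** x)); last by lin.
  by rewrite -tliftZ; apply: eq_tlift => t2 t3; rewrite mulZr scalerA mulrC.
rewrite /Ad.
rewrite tlift_exch.
deepn 3 (rewrite tlift_exch).
deepn 2 (rewrite tlift_exch).
deepn 1 (rewrite coassoc).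
deepn 4 (rewrite tlift_exch).
deepn 3 (rewrite tlift_exch).
deepn 2 (rewrite coassoc).
deepn 3 (rewrite -coassoc).
deepn 4 (rewrite tlift_exch).
deepn 6 (rewrite 2!antipodeM !mulA -(mulA _ (S (S _)) (S _)) -antipodeM).
deepn 5 (eapply sw_antipoder; [abstract_arg|lin]).
deepn 4 (rewrite tliftZ).
deepn 3 (rewrite sw_counitl).
deepn 2 (rewrite -coassoc).
deepn 3 (eapply sw_antipodeVr; [abstract_arg|lin]).
deepn 2 (rewrite sw_counitl).
deepn 1 (eapply sw_antipoder; [abstract_arg|lin]).
have -> : ε ((f 𝟙 : k) *: h) = (ε h : k) * (f 𝟙 : k) by rewrite linearZ; apply: mulrC.
rewrite tliftZ -scalerA; congr (_ *: _).
deepn 1 (rewrite antipode1 mul_1r mul_1l).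
rewrite (sw_antipodel (G := fun u => (f u : k) *: 𝟙)) //; last by lin.
by rewrite !scalerA mulrC.
Qed.

(** Here the value at a is f(h5 a1 S^{-1}(h3) h2 S(a2) S(h6)) S^{-1}(h4) h1. The cancellations are
    h2 with h3, h1 with h4, a1 with S(a2), then h5 with h6. *)
Lemma double_antipoder x :
  (sw( x1 , x2 <- comult DD x ) hmul DD x1 (double_antipode x2)) = (counit DD x : k) *: hone DD.
Proof.
move: x; apply: tens_ind; [by lin|by lin|] => h f.
apply: double_eval_ext => a.
rewrite double_counitE double_eval_tens [RHS](linear_scaleE (L := double_eval a)); last by lin.
rewrite [in RHS]double_one_eval.
transitivity (sw( h1 , h2 <- Δ h ) sw( a1 , a2 <- Δ a )
  sw( t1 , t' <- Δ h2 ) sw( t2 , t3 <- Δ t' ) Ad (fun u b =>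
  (f (b ** (t1 ** S a2 ** S t3)) : k) *: (u ** h1)) (Sb t2) a1).
  rewrite double_comultE [X in X @@ _]tlift_comp (map_tlift (L := fun x => x @@ a)); last by lin.
  apply: eq_tlift => h1 h2; rewrite [X in X @@ _]tlift_comp (map_tlift (L := fun x => x @@ a)); last by lin.
  rewrite /Ad; symmetry.
  deepn 5 (rewrite (dual_comult_scale f)).
  deepn 4 (rewrite tlift_exch).
  deepn 3 (rewrite tlift_exch).
  deepn 2 (rewrite tlift_exch).
  deepn 1 (rewrite tlift_exch).
  rewrite tlift_exch; apply: eq_tlift => f1 f2.
  rewrite tlift_tens; last by lin.
  rewrite double_evalM; apply: eq_tlift => a1 a2.
  have [Adl _] := Ad_eval_bilin (h1 \ox f1).
  rewrite double_antipode_eval [RHS](map_tlift (L := fun z => Ad _ z a1)) //; apply: eq_tlift => t1 t'.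
  rewrite [RHS](map_tlift (L := fun z => Ad _ z a1)) //; apply: eq_tlift => t2 t3.
  rewrite [RHS](linear_scaleE (L := fun z => Ad _ z a1)) // /Ad.
  rewrite -tliftZ; apply: eq_tlift => u1 u'; rewrite -tliftZ; apply: eq_tlift => u2 u3.
  by rewrite double_eval_tens mulZr scalerA mulrC.
rewrite /Ad.
deepn 4 (rewrite sw_antipodeV).
deepn 5 (rewrite sw_antipodeV).
rewrite tlift_exch.
deepn 3 (rewrite coassoc).
deepn 4 (rewrite tlift_exch).
deepn 3 (rewrite coassoc).
deepn 2 (rewrite -coassoc).
deepn 3 (rewrite tlift_exch).
deepn 4 (rewrite tlift_exch).
deepn 6 (rewrite !mulA -(mulA _ (Sb _) _) antipodeVK).
deepn 5 (eapply sw_antipodeVl; [abstract_arg|lin]).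
deepn 4 (rewrite tliftZ).
deepn 3 (rewrite tliftZ).
deepn 2 (rewrite sw_counitl).
deepn 1 (rewrite -coassoc).
deepn 2 (rewrite tlift_exch).
deepn 3 (eapply sw_antipodeVl; [abstract_arg|lin]).
deepn 2 (rewrite tliftZ).
deepn 1 (rewrite sw_counitl).
rewrite tlift_exch.
deepn 2 (rewrite mul_1r -!mulA [X in _ ** X]mulA).
deepn 1 (eapply sw_antipoder; [abstract_arg|lin]).
deepn 1 (rewrite mul_1l).
rewrite tliftZ (sw_antipoder (G := fun u => (f u : k) *: 𝟙)) //; last by lin.
have -> : ε ((f 𝟙 : k) *: h) = (ε h : k) * (f 𝟙 : k) by rewrite linearZ; apply: mulrC.
by rewrite !scalerA mulrC.
Qed.

Lemma double_ordinary_antipode : is_antipode DD double_antipode.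
Proof.
split; [| exact: double_antipodel | exact: double_antipoder].
by move=> x; rewrite twistD1 !id_lfunE.
Qed.

(** * The R-matrix of the ordinary double *)

Section RMatrix.
Variables (n : nat) (h : n.-tuple H) (hd : 'I_n -> 'Hom(H, k^o)).
Hypotheses (h_basis : basis_of fullv h) (hd_dual : forall i j, hd i (tnth h j) = (i == j)%:R).

Definition double_R : tensor HH HH :=
  \sum_(i < n) (hone D \ox hd i) \ox (Sb (tnth h i) \ox counit D).
Notation R := double_R.

Lemma dual_basis_sum W (F : H -> W) x : linear F ->
  \sum_i (hd i x : k) *: F (tnth h i) = F x.
Proof.
move=> lF; rewrite -(linear_sumE _ _ lF); congr (F _).
rewrite [RHS](coord_basis h_basis (memvf x)).
apply: eq_bigr => i _; rewrite (tnth_nth 0); congr (_ *: _).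
rewrite {1}(coord_basis h_basis (memvf x)).
rewrite linear_sum (bigD1 i) //= -tnth_nth linearZ /= hd_dual eqxx big1 ?addr0.
  exact: mulr1.
by move=> j ji; rewrite -tnth_nth linearZ /= hd_dual eq_sym (negPf ji); apply: mulr0.
Qed.

(** The dual basis pairs with a and rebuilds S^{-1}(a), so the value does not depend on the chosen
    basis. *)
Lemma R_eval a b : tmap (double_eval a) (double_eval b) R = 𝟙 \ox ((ε b : k) *: Sb a).
Proof.
rewrite /double_R (linear_sum1 (L := tmap _ _)); last by lin.
rewrite -(dual_basis_sum (F := fun a => 𝟙 \ox ((ε b : k) *: Sb a))); last by lin.
apply: eq_bigr => i _; rewrite tmap_tens !double_eval_tens.
by rewrite (linear_scaleE (L := fun u => u \ox _)) //; lin.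
Qed.

Lemma R_counitl : (sw( a , b <- R ) (counit DD a : k) *: b) = hone DD.
Proof.
apply: double_eval_ext => a; rewrite (map_tlift (L := fun x => x @@ a)); last by lin.
transitivity (tlift (fun p q => (ε p : k) *: q) (tmap (double_eval 𝟙) (double_eval a) R)).
  rewrite tlift_tmap; last by lin.
  by apply: eq_tlift => x y; rewrite linearZ double_counitE.
rewrite R_eval tlift_tens; last by lin.
by rewrite (counit1 hD) scale1r (antipodeV1) double_one_eval.
Qed.

Lemma R_counitr : (sw( a , b <- R ) (counit DD b : k) *: a) = hone DD.
Proof.
apply: double_eval_ext => a; rewrite (map_tlift (L := fun x => x @@ a)); last by lin.
transitivity (tlift (fun p q => (ε q : k) *: p) (tmap (double_eval a) (double_eval 𝟙) R)).
  rewrite tlift_tmap; last by lin.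
  by apply: eq_tlift => x y; rewrite linearZ double_counitE.
rewrite R_eval tlift_tens; last by lin.
by rewrite (counit1 hD) scale1r counit_antipodeV double_one_eval.
Qed.

(** On the left, conjugation by S^{-1} of a leg of a evaluates x at a4 b S^{-1}(a2) a1 and
    multiplies by S^{-1}(a3), where S^{-1}(a2) a1 cancels. On the right, with y the value of x at a2
    b, the second leg is y4 S^{-1}(y3) S^{-1}(a1) y1, where y4 S^{-1}(y3) cancels. Both
    cancellations need the inverse antipode in R. *)
Lemma R_comm x :
  hmul2 DD (tswap _ _ (comult DD x)) R = hmul2 DD R (comult DD x).
Proof.
have ex := lin_double_eval x.
apply: double_eval_ext2 => a b; rewrite !double_evalM2.
transitivity (sw( a1 , a2 <- Δ a ) sw( p , q <- Δ (x @@ (a2 ** b)) ) q \ox (Sb a1 ** p)).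
  transitivity (sw( a1 , a2 <- Δ a ) Ad (fun v d =>
      sw( p , q <- Δ (x @@ (d ** a1)) ) q \ox (v ** p)) (Sb a2) b).
    apply: eq_tlift => a1 a2.
    rewrite -[RHS](sw_counitr (F := fun b => Ad _ (Sb a2) b)); last by rewrite /Ad; lin.
    apply: eq_tlift => b1 b2; rewrite R_eval tlift_tens; last by rewrite /Ad; lin.
    rewrite Ad_one; last by rewrite /Ad; lin.
    rewrite (linear_scaleE (L := fun z => Ad _ z b1)); last by rewrite /Ad; lin.
    congr (_ *: _); apply: eq_Ad => v d.
    rewrite tswap_nat double_eval_comult tlift_swap; last by lin.
    by apply: eq_tlift => p q; rewrite mul_1l.
  rewrite /Ad.
  deepn 1 (rewrite sw_antipodeV).
  deepn 2 (rewrite sw_antipodeV).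
  deepn 1 (rewrite coassoc).
  rewrite -coassoc; last by lin.
  deepn 1 (rewrite tlift_exch).
  deepn 3 (rewrite -(mulA _ (Sb _) _) antipodeVK).
  deepn 2 (eapply sw_antipodeVl; [abstract_arg|lin]).
  deepn 1 (rewrite tliftZ).
  rewrite sw_counitl; last by lin.
  by apply: eq_tlift => a1 a2; rewrite mul_1r.
symmetry; apply: eq_tlift => a1 a2.
transitivity (sw( b1 , b2 <- Δ b ) (ε b1 : k) *: sw( y , y' <- Δ (x @@ (a2 ** b2)) )
   Ad (fun u c => u \ox (y' ** Sb c)) y a1).
  apply: eq_tlift => b1 b2; rewrite double_eval_comult -tliftZ.
  apply: eq_tlift => y y'.
  rewrite [RHS](map_Ad (L := fun u => (ε b1 : k) *: u)); last by lin.
  apply: eq_Ad => u c.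
  rewrite -(Ad_counit (G := fun v => u \ox (v ** Sb c))); last by lin.
  apply: eq_Ad => v d; rewrite R_eval tlift_tens; last by lin.
  by rewrite mul_1r mulZr (linear_scaleE (L := fun v => u \ox v)) //; lin.
rewrite sw_counitl; last by rewrite /Ad; lin.
rewrite /Ad coassoc; last by lin.
deepn 1 (rewrite coassoc).
deepn 3 (rewrite !antipodeVM antipodeK mulA).
deepn 2 (eapply sw_antipodeVr; [abstract_arg|lin]).
deepn 1 (rewrite sw_counitr).
by apply: eq_tlift => p q; rewrite mul_1l.
Qed.

Lemma hmul2_tens a b c d :
  hmul2 DD (a \ox b) (c \ox d) = hmul DD a c \ox hmul DD b d.
Proof. by rewrite /hmul2 tmul_tens //; apply: hmul_bilin. Qed.

Lemma hmul3_tens a b c d p q :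
  hmul3 DD (a \ox b \ox p) (c \ox d \ox q) = hmul DD a c \ox hmul DD b d \ox hmul DD p q.
Proof.
rewrite /hmul3 tmul_tens ?hmul2_tens //; last exact: hmul_bilin.
by apply: tmul_bilin; apply: hmul_bilin.
Qed.

Lemma hmul3_sum (s t : 'I_n -> tensor (tensor HH HH) HH) :
  hmul3 DD (\sum_i s i) (\sum_j t j) = \sum_i \sum_j hmul3 DD (s i) (t j).
Proof.
have [m3l m3r] : bilin (hmul3 DD).
  by do 2 ?apply: tmul_bilin; apply: hmul_bilin.
rewrite (linear_sum1 (L := fun s => hmul3 DD s _)); last exact: m3l.
by apply: eq_bigr => i _; rewrite (linear_sum1 (L := hmul3 DD _)) //; apply: m3r.
Qed.

Lemma R_sum W (F : HH -> HH -> W) : bilin F ->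
  tlift F R = \sum_i F (hone D \ox hd i) (Sb (tnth h i) \ox counit D).
Proof.
move=> bF; rewrite /double_R (linear_sum1 (L := tlift F)); last by lin.
by apply: eq_bigr => i _; rewrite tlift_tens.
Qed.

(** [H^*] is a subalgebra of the double, and by the next lemma so is H with the opposite product.
    Every product in R13 R23 and R13 R12 lies in one of them or has a unit as a factor. *)
Lemma double_mul_dual f g : hmul DD (𝟙 \ox f) (𝟙 \ox g) = 𝟙 \ox hmul (dual_data D) f g.
Proof.
apply: double_eval_ext => a; rewrite double_evalM double_eval_tens dual_mulE.
rewrite [RHS](map_tlift (L := fun c : k^o => (c : k) *: 𝟙)); last by lin.
apply: eq_tlift => a1 a2; rewrite double_eval_tens.
have [bl _] := Ad_eval_bilin (𝟙 \ox f).
rewrite (linear_scaleE (L := fun z => Ad _ z a1)) // Ad_one; last exact: mul_eval_bilin.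
by rewrite mul_1l double_eval_tens scalerA mulrC.
Qed.

Lemma double_mul_op x y : hmul DD (x \ox ε) (y \ox ε) = (y ** x) \ox ε.
Proof.
apply: double_eval_ext => a; rewrite double_evalM double_eval_tens.
rewrite -[RHS](sw_counitr (F := fun a => (ε a : k) *: (y ** x))); last by lin.
apply: eq_tlift => a1 a2; rewrite double_eval_tens.
have [bl _] := Ad_eval_bilin (x \ox ε).
rewrite (linear_scaleE (L := fun z => Ad _ z a1)) //; congr (_ *: _).
rewrite -(Ad_counit (G := fun u => u ** x)); last by lin.
by apply: eq_Ad => u b; rewrite double_eval_tens mulZr.
Qed.

Lemma double_eval_ext3l (s t : tensor (tensor HH HH) HH) :
  (forall a b c, tmap (tmap (double_eval a) (double_eval b)) (double_eval c) s =
                 tmap (tmap (double_eval a) (double_eval b)) (double_eval c) t) ->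
  s = t.
Proof.
move=> st; apply/eqP; rewrite -subr_eq0; apply/eqP.
apply: (tens_sep (P := fun ab : H * H => tmap (double_eval ab.1) (double_eval ab.2)) (Q := double_eval)).
- move=> u u0; apply: double_eval_ext2 => a b; rewrite (u0 (a, b)).
  by rewrite linear0.
- exact: double_eval_sep.
by move=> [a b] c; rewrite linearB /= st subrr.
Qed.

(** Both sides encode S^{-1}(a b) in the third leg: the reversal of products by S^{-1} matches the
    opposite product of the basis elements. *)
Lemma R_comultl :
  tmap (comult DD) \1%VF R = hmul3 DD (R13 DD R) (R23 DD R).
Proof.
rewrite /R13 /R23 !R_sum; try by lin.
rewrite hmul3_sum; apply: double_eval_ext3l => a b c.
pose G x : tensor (tensor H H) H := 𝟙 \ox 𝟙 \ox ((ε c : k) *: x).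
have ZG (d : k) x : G (d *: x) = d *: G x by rewrite linear_scaleE // /G; lin.
transitivity (G (Sb (a ** b))).
  rewrite -(dual_basis_sum (F := fun x => G (Sb x))); last by rewrite /G; lin.
  rewrite (linear_sum1 (L := tmap _ _)); last by lin.
  apply: eq_bigr => i _; rewrite tmap_tens double_eval_comult id_lfunE !double_eval_tens.
  rewrite linearZ /= (comult1 hD).
  by rewrite (linear_scaleE (L := fun u => u \ox _)) //; lin.
rewrite antipodeVM -(dual_basis_sum (F := fun x => G (Sb b ** Sb x))); last by rewrite /G; lin.
rewrite [RHS](linear_sum1 (L := tmap _ _)); last by lin.
apply: eq_bigr => i _.
rewrite -(dual_basis_sum (F := fun x => G (Sb x ** Sb (tnth h i)))); last by rewrite /G; lin.
rewrite [RHS](linear_sum1 (L := tmap _ _)) ?scaler_sumr; last by lin.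
apply: eq_bigr => j _.
rewrite hmul3_tens double_mul1r double_mul1l double_mul_op !tmap_tens !double_eval_tens /G.
rewrite (linear_scaleE (L := fun u => u \ox (_ *: 𝟙) \ox _)); last by lin.
by rewrite (linear_scaleE (L := fun u => _ \ox u \ox _)) //; lin.
Qed.

(** The product f_i f_j pairs with Δ(a), while R13 puts h_i in the third leg and R12 puts h_j in the
    second. This is the flip in Δ(S^{-1}(a)), which is S^{-1}(a2) \ox S^{-1}(a1). *)
Lemma R_comultr :
  tmap \1%VF (comult DD) R = tassoc _ _ _ (hmul3 DD (R13 DD R) (R12 DD R)).
Proof.
rewrite /R13 /R12 !R_sum; try by lin.
rewrite hmul3_sum; apply: double_eval_ext3 => a b c.
pose G x y : tensor H (tensor H H) := 𝟙 \ox (((ε b : k) *: y) \ox ((ε c : k) *: x)).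
transitivity (sw( a1 , a2 <- Δ a ) G (Sb a1) (Sb a2)).
  rewrite -(dual_basis_sum (F := fun a => tlift _ (Δ a))); last by rewrite /G; lin.
  rewrite (linear_sum1 (L := tmap _ _)); last by lin.
  apply: eq_bigr => i _; rewrite tmap_tens id_lfunE double_eval_comult !double_eval_tens.
  rewrite (linear_scaleE (L := fun u => u \ox _)); last by lin.
  congr (_ *: _); rewrite linearZ /= -[X in _ *: X]tens_gen sw_antipodeV; last by lin.
  rewrite (counitM hD) -tliftZ (map_tlift (L := fun u => 𝟙 \ox u)); last by lin.
  apply: eq_tlift => p q; rewrite /G.
  rewrite (linear_scaleE (L := fun u => u \ox _)) ?(linear_scaleE (L := fun u => Sb q \ox u)) ?scalerA //; lin.
rewrite !(linear_sum1 (L := tassoc _ _ _)); last by lin.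
rewrite [RHS](linear_sum1 (L := tmap _ _)); last by lin.
transitivity (sw( a1 , a2 <- Δ a ) \sum_i \sum_j
   ((hd i a1 : k) * (hd j a2 : k)) *: G (Sb (tnth h i)) (Sb (tnth h j))).
  apply: eq_tlift => a1 a2.
  rewrite -(dual_basis_sum (F := fun x => G (Sb x) _)); last by rewrite /G; lin.
  apply: eq_bigr => i _.
  rewrite -(dual_basis_sum (F := fun x => G _ (Sb x))); last by rewrite /G; lin.
  by rewrite scaler_sumr; apply: eq_bigr => j _; rewrite scalerA.
rewrite tlift_sum; apply: eq_bigr => i _.
rewrite tlift_sum [RHS](linear_sum1 (L := fun t => tmap _ _ (tassoc _ _ _ t))); last by lin.
apply: eq_bigr => j _.
rewrite hmul3_tens double_mul1r double_mul1l double_mul_dual tassoc_tens !tmap_tens !double_eval_tens dual_mulE.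
rewrite [RHS](linear_scaleE (L := fun u => u \ox _)); last by lin.
by rewrite [RHS](map_tlift (L := fun c : k^o => (c : k) *: G (Sb (tnth h i)) (Sb (tnth h j)))) //; lin.
Qed.

Lemma double_ordinary_quasitriangular : is_quasitriangular DD R.
Proof.
have tV : (twist DD)^-1%VF = \1%VF by rewrite twistD1 inv_lfun1.
split.
- by split; [exact: double_ordinary_bialgebra | exists double_antipode; exact: double_ordinary_antipode].
- exact: R_counitl.
- exact: R_counitr.
- exact: R_comm.
- by rewrite tV R_comultl.
- by rewrite tV R_comultr.
Qed.

End RMatrix.
End Antipode.
End Ordinary.

(** * Twisting by an automorphism *)

Section Twisting.
Variables (k : fieldType) (A : vectType k).

Record is_hom_automorphism (D : hom_data A) (φ : 'End(A)) : Prop := IsHomAutomorphism {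
  aut_inj : injective φ;
  aut_twist : forall x, φ (twist D x) = twist D (φ x);
  autM : forall x y, φ (hmul D x y) = hmul D (φ x) (φ y);
  aut1 : φ (hone D) = hone D;
  aut_comult : forall x, comult D (φ x) = tmap φ φ (comult D x);
  aut_counit : forall x, counit D (φ x) = counit D x
}.

(** The coproduct is composed with the inverse because the counit axioms return the inverse of the
    twist. *)
Definition twisted (D : hom_data A) (φ : 'End(A)) : hom_data A := {|
  twist := (φ \o twist D)%VF;
  mult := (φ \o mult D)%VF;
  hone := hone D;
  comult := (tmap φ^-1 φ^-1 \o comult D)%VF;
  counit := counit D
|}.

Variables (D : hom_data A) (φ : 'End(A)).
Hypotheses (hφ : is_hom_automorphism D φ).
Notation V := (φ^-1)%VF.
Notation T := (twisted D φ).

Lemma autK : cancel φ V. Proof. exact: lfun_injK (aut_inj hφ). Qed.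
Lemma autVK : cancel V φ. Proof. exact: lfun_injVK (aut_inj hφ). Qed.

Lemma aut_comp : (φ \o V)%VF = \1%VF.
Proof. by apply/lfunP => x; rewrite comp_lfunE autVK id_lfunE. Qed.

Lemma aut_compV : (V \o φ)%VF = \1%VF.
Proof. by apply/lfunP => x; rewrite comp_lfunE autK id_lfunE. Qed.

Lemma aut_inverse : is_hom_automorphism D V.
Proof.
split.
- exact: can_inj autVK.
- by move=> x; apply: (aut_inj hφ); rewrite (aut_twist hφ) !autVK.
- by move=> x y; apply: (aut_inj hφ); rewrite (autM hφ) !autVK.
- by apply: (aut_inj hφ); rewrite (aut1 hφ) !autVK.
- move=> x; rewrite -{2}[x]autVK (aut_comult hφ) tmap_comp aut_compV tmap_id.
  by rewrite id_lfunE.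
- by move=> x; rewrite -{2}[x]autVK (aut_counit hφ).
Qed.

Lemma twisted_mulE x y : hmul T x y = φ (hmul D x y).
Proof. by rewrite /hmul /= comp_lfunE. Qed.

Lemma twisted_comultE x : comult T x = tmap V V (comult D x).
Proof. by rewrite /= comp_lfunE. Qed.

Lemma twisted_twistE x : (twist T : 'End(A)) x = φ (twist D x).
Proof. by rewrite /= comp_lfunE. Qed.

Lemma hmul2_nat (ψ : 'End(A)) s t : (forall x y, ψ (hmul D x y) = hmul D (ψ x) (ψ y)) ->
  hmul2 D (tmap ψ ψ s) (tmap ψ ψ t) = tmap ψ ψ (hmul2 D s t).
Proof.
move=> ψM; have bm := hmul_bilin D; have b2 : bilin (hmul2 D) by apply: tmul_bilin.
move: s; apply: tens_ind; [by lin|by lin|] => a b.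
move: t; apply: tens_ind; [by lin|by lin|] => c d.
by rewrite !tmap_tens /hmul2 !tmul_tens // tmap_tens !ψM.
Qed.

Lemma hmul3_nat (ψ : 'End(A)) s t : (forall x y, ψ (hmul D x y) = hmul D (ψ x) (ψ y)) ->
  hmul3 D (tmap (tmap ψ ψ) ψ s) (tmap (tmap ψ ψ) ψ t) = tmap (tmap ψ ψ) ψ (hmul3 D s t).
Proof.
move=> ψM; have bm := hmul_bilin D; have b2 : bilin (hmul2 D) by apply: tmul_bilin.
have b3 : bilin (hmul3 D) by apply: tmul_bilin.
move: s; apply: tens_ind; [by lin|by lin|] => a b.
move: t; apply: tens_ind; [by lin|by lin|] => c d.
by rewrite !tmap_tens /hmul3 !tmul_tens // tmap_tens ψM hmul2_nat.
Qed.

Lemma hmul2_twisted s t : hmul2 T s t = tmap φ φ (hmul2 D s t).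
Proof.
have bm := hmul_bilin D; have b2 : bilin (hmul2 D) by apply: tmul_bilin.
have bmT := hmul_bilin T; have b2T : bilin (hmul2 T) by apply: tmul_bilin.
move: s; apply: tens_ind; [by lin|by lin|] => a b.
move: t; apply: tens_ind; [by lin|by lin|] => c d.
by rewrite /hmul2 !tmul_tens // tmap_tens !twisted_mulE.
Qed.

Lemma hmul3_twisted s t : hmul3 T s t = tmap (tmap φ φ) φ (hmul3 D s t).
Proof.
have bm := hmul_bilin D; have b2 : bilin (hmul2 D) by apply: tmul_bilin.
have bmT := hmul_bilin T; have b2T : bilin (hmul2 T) by apply: tmul_bilin.
have b3 : bilin (hmul3 D) by apply: tmul_bilin.
have b3T : bilin (hmul3 T) by apply: tmul_bilin.
move: s; apply: tens_ind; [by lin|by lin|] => a b.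
move: t; apply: tens_ind; [by lin|by lin|] => c d.
by rewrite /hmul3 !tmul_tens // tmap_tens twisted_mulE hmul2_twisted.
Qed.

Lemma twisted_twistV : bijective (twist D) -> (twist T)^-1%VF = (V \o (twist D)^-1)%VF.
Proof.
move=> bD; have iD := bij_inj bD.
have iT : injective (twist T).
  by move=> x y; rewrite !twisted_twistE => /(aut_inj hφ) /iD.
apply/lfunP => x; rewrite -[RHS](lfun_injK iT) twisted_twistE comp_lfunE.
by rewrite (aut_twist hφ) autVK (lfun_injVK iD).
Qed.

Lemma autV_twistV : bijective (twist D) ->
  (V \o (twist D)^-1)%VF = ((twist D)^-1 \o V)%VF.
Proof.
move=> /bij_inj iD; apply/lfunP => x; rewrite !comp_lfunE; apply: (iD).
by rewrite -(aut_twist aut_inverse) (lfun_injVK iD) (lfun_injVK iD).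
Qed.

Lemma twisted_bialgebra : is_hom_bialgebra D -> is_hom_bialgebra T.
Proof.
move=> hD; have aD := bialg_alg hD; have cD := bialg_coalg hD.
have bD := twist_bij_alg aD; have tV := twisted_twistV bD.
have hV := aut_inverse.
have bT : bijective (twist T).
  have [g gK Kg] := bD; exists (fun x => g (V x)) => x.
    by rewrite twisted_twistE autK gK.
  by rewrite twisted_twistE Kg autVK.
split.
- split=> //.
  + by move=> a b c; rewrite !twisted_mulE !twisted_twistE -!(autM hφ) (hmulA aD).
  + by move=> a; rewrite twisted_mulE twisted_twistE (hmul1r aD).
  + by move=> a; rewrite twisted_mulE twisted_twistE (hmul1l aD).
  + move=> a b; rewrite !twisted_mulE !twisted_twistE -(aut_twist hφ) (twistM aD).
    by rewrite !(autM hφ).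
  + by rewrite twisted_twistE /= (twist1 aD) (aut1 hφ).
- split=> //.
  + move=> c; rewrite tV twisted_comultE !tmap_comp.
    (* Both sides of coassociativity acquire the same factor [V \o V] on each of the three legs. *)
    have e : (comult T \o V)%VF = (tmap (V \o V) (V \o V) \o comult D)%VF.
      by apply/lfunP => x; rewrite !comp_lfunE (aut_comult hV) tmap_comp.
    have e' : ((V \o (twist D)^-1) \o V)%VF = ((V \o V) \o (twist D)^-1)%VF.
      by rewrite -comp_lfunA -(autV_twistV bD) comp_lfunA.
    by rewrite e e' -!tmap_comp (comultA cD) tassoc_nat.
  + move=> c; rewrite tV twisted_comultE tlift_tmap; last by lin.
    rewrite comp_lfunE -(counitr cD) (map_tlift (L := V)); last by lin.
    by apply: eq_tlift => a b; rewrite (aut_counit hV) linearZ.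
  + move=> c; rewrite tV twisted_comultE tlift_tmap; last by lin.
    rewrite comp_lfunE -(counitl cD) (map_tlift (L := V)); last by lin.
    by apply: eq_tlift => a b; rewrite (aut_counit hV) linearZ.
  + move=> c; rewrite !twisted_comultE twisted_twistE (aut_comult hφ) (comult_twist cD).
    rewrite !tmap_comp; congr (tmap _ _ _); apply/lfunP => x;
      by rewrite !comp_lfunE autK (aut_twist hφ) autVK.
  + by move=> c; rewrite twisted_twistE /= (aut_counit hφ) (counit_twist cD).
- move=> a b; rewrite !twisted_comultE twisted_mulE (aut_comult hφ) tmap_comp aut_compV.
  rewrite tmap_id id_lfunE (comultM hD) -/(hmul2 T) -/(hmul2 D).
  rewrite hmul2_twisted hmul2_nat; last exact: autM hV.
  by rewrite tmap_comp aut_comp tmap_id id_lfunE.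
- by rewrite twisted_comultE (comult1 hD) tmap_tens (aut1 hV).
- by move=> a b; rewrite twisted_mulE /= (aut_counit hφ) (counitM hD).
- exact: counit1 hD.
Qed.

(** The same S works: [φ] in the product cancels the two copies of its inverse in the coproduct. *)
Lemma twisted_antipode (S : 'End(A)) : (forall x, S (φ x) = φ (S x)) -> is_antipode D S -> is_antipode T S.
Proof.
move=> Sφ hS.
have SV x : S (V x) = V (S x) by apply: (aut_inj hφ); rewrite -Sφ !autVK.
have MV := autM aut_inverse.
split.
- by move=> h; rewrite !twisted_twistE Sφ (antipode_twist hS).
- move=> h; rewrite twisted_comultE tlift_tmap -?(antipodel hS); last by lin.
  by apply: eq_tlift => a b; rewrite twisted_mulE SV -MV autVK.
- move=> h; rewrite twisted_comultE tlift_tmap -?(antipoder hS); last by lin.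
  by apply: eq_tlift => a b; rewrite twisted_mulE SV -MV autVK.
Qed.

Lemma R13_nat (ψ : 'End(A)) R : ψ (hone D) = hone D ->
  tmap (tmap ψ ψ) ψ (R13 D R) = R13 D (tmap ψ ψ R).
Proof.
move=> ψ1; rewrite /R13 tlift_tmap; last by lin.
rewrite (map_tlift (L := tmap _ _)); last by lin.
by apply: eq_tlift => a b; rewrite !tmap_tens ψ1.
Qed.

Lemma R12_nat (ψ : 'End(A)) R : ψ (hone D) = hone D ->
  tmap (tmap ψ ψ) ψ (R12 D R) = R12 D (tmap ψ ψ R).
Proof.
move=> ψ1; rewrite /R12 tlift_tmap; last by lin.
rewrite (map_tlift (L := tmap _ _)); last by lin.
by apply: eq_tlift => a b; rewrite !tmap_tens ψ1.
Qed.

Lemma R23_nat (ψ : 'End(A)) R : ψ (hone D) = hone D ->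
  tmap (tmap ψ ψ) ψ (R23 D R) = R23 D (tmap ψ ψ R).
Proof.
move=> ψ1; rewrite /R23 tlift_tmap; last by lin.
rewrite (map_tlift (L := tmap _ _)); last by lin.
by apply: eq_tlift => a b; rewrite !tmap_tens ψ1.
Qed.

(** Each axiom changes only by maps [φ] or its inverse applied to all legs; these commute with
    products and are absorbed by the invariance of R. *)
Lemma twisted_quasitriangular R : tmap φ φ R = R ->
  is_hom_hopf T -> is_quasitriangular D R -> is_quasitriangular T R.
Proof.
move=> Rφ hT [[hD _] Rl Rr Rc Rcl Rcr].
have hV := aut_inverse.
have bD := twist_bij_alg (bialg_alg hD); have tV := twisted_twistV bD.
have RV : tmap V V R = R by rewrite -{1}Rφ tmap_comp aut_compV tmap_id id_lfunE.
split=> //.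
- move=> x; rewrite !hmul2_twisted twisted_comultE -tswap_nat -{1 2}RV.
  by rewrite !hmul2_nat ?Rc //; apply: autM hV.
- rewrite tV hmul3_twisted.
  rewrite -hmul3_nat ?R13_nat ?R23_nat ?Rφ -?Rcl; [|exact: aut1|exact: aut1|exact: autM].
  transitivity (tmap (tmap V V) V (tmap (comult D) (twist D)^-1%VF R)).
    by rewrite tmap_comp.
  rewrite Rcl -hmul3_nat ?R13_nat ?R23_nat ?RV //; [exact: aut1 hV|exact: aut1 hV|exact: autM hV].
- rewrite tV hmul3_twisted.
  rewrite -hmul3_nat ?R13_nat ?R12_nat ?Rφ -?Rcr; [|exact: aut1|exact: aut1|exact: autM].
  transitivity (tmap V (tmap V V) (tmap (twist D)^-1%VF (comult D) R)).
    by rewrite tmap_comp.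
  rewrite Rcr tassoc_nat -hmul3_nat ?R13_nat ?R12_nat ?RV //;
    [exact: aut1 hV|exact: aut1 hV|exact: autM hV].
Qed.

End Twisting.

(** * The Drinfel'd double of a monoidal Hom-Hopf algebra *)

Section DoubleAutomorphism.
Variables (k : fieldType) (H : vectType k) (D : hom_data H) (S α : 'End(H)).
Hypotheses (hD : is_hom_bialgebra D) (twist1 : twist D = \1%VF) (hS : is_antipode D S).
Hypotheses (hα : is_hom_automorphism D α) (Sα : forall x, S (α x) = α (S x)).
Notation Hd := 'Hom(H, k^o).
Notation HH := (tensor H Hd).
Notation DD := (double_data D S).
Notation "x @@ a" := (double_eval a x) (at level 35).
(** Prescribed only as conjugation by [α] on endomorphisms, since it will be the twist of the double
    of the Hom-structure, whereas [D] is the untwisted structure here. *)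
Variable γ : 'End(HH).
Hypothesis γE : forall x a, γ x @@ a = α (x @@ (α^-1%VF a)).

Let αK := autK hα.
Let αVK := autVK hα.

Lemma Ad_automorphism (W : vectType k) (F : H -> H -> W) z a : bilin F ->
  Ad D S F (α z) (α a) = Ad D S (fun u b => F (α u) (α b)) z a.
Proof.
move=> bF; rewrite /Ad (aut_comult hα) tlift_tmap; last by lin.
deepn 1 (rewrite (aut_comult hα) tlift_tmap).
by apply: eq_tlift => ? ?; apply: eq_tlift => ? ?; rewrite Sα !(autM hα).
Qed.

Lemma double_automorphism : is_hom_automorphism DD γ.
Proof.
have hV := aut_inverse hα.
split.
- move=> x y xy; apply: double_eval_ext => a; apply: (aut_inj hα).
  by rewrite -[a]αK -!γE xy.
- by move=> x; rewrite twistD1 // !id_lfunE.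
- move=> x y; apply: double_eval_ext => a.
  rewrite γE !double_evalM // -{2}[a]αVK (aut_comult hα) tlift_tmap; last first.
    have := Ad_eval_bilin D S (γ x); have := lin_double_eval (γ y); by lin.
  rewrite (map_tlift (L := α)); last by lin.
  apply: eq_tlift => a1 a2; rewrite γE αK Ad_automorphism; last exact: mul_eval_bilin.
  rewrite (map_Ad _ _ (L := α)); last by lin.
  by apply: eq_Ad => u b; rewrite γE αK (autM hα).
- apply: double_eval_ext => a; rewrite γE !double_one_eval linearZ /= (aut1 hα).
  by rewrite (aut_counit hV).
- move=> x; apply: double_eval_ext2 => a b.
  rewrite double_eval_comult tmap_comp γE (autM hV).
  have e p : (double_eval p \o γ)%VF = (α \o double_eval (α^-1%VF p))%VF.
    by apply/lfunP => y; rewrite !comp_lfunE γE.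
  by rewrite !e -tmap_comp double_eval_comult (aut_comult hα).
- by move=> x; rewrite !double_counitE γE (aut1 hV) (aut_counit hα).
Qed.

Lemma antipodeV_automorphism x : (S^-1)%VF (α x) = α ((S^-1)%VF x).
Proof. by apply: (antipode_inj hD twist1 hS); rewrite Sα !(antipodeVK hD twist1 hS). Qed.

Lemma double_antipode_automorphism x :
  double_antipode D S (γ x) = γ (double_antipode D S x).
Proof.
move: x; apply: tens_ind; [by lin|by lin|] => h f.
have -> : γ (h \ox f) = α h \ox (f \o α^-1)%VF.
  by apply: double_eval_ext => a; rewrite γE !double_eval_tens linearZ comp_lfunE.
apply: double_eval_ext => a; rewrite γE !double_antipode_eval.
rewrite (map_tlift (L := α)); last by lin.
rewrite (aut_comult hα) tlift_tmap; last by lin.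
apply: eq_tlift => h1 h'; rewrite (map_tlift (L := α)); last by lin.
rewrite (aut_comult hα) tlift_tmap; last by lin.
apply: eq_tlift => h2 h3; rewrite linearZ antipodeV_automorphism comp_lfunE.
by rewrite !(autM (aut_inverse hα)) Sα !αK -{1}[a]αVK Sα αK.
Qed.

Lemma double_R_automorphism (n : nat) (h : n.-tuple H) (hd : 'I_n -> 'Hom(H, k^o))
  (h_basis : basis_of fullv h) (hd_dual : forall i j, hd i (tnth h j) = (i == j)%:R) :
  tmap γ γ (double_R D S h hd) = double_R D S h hd.
Proof.
have hV := aut_inverse hα.
apply: double_eval_ext2 => a b; rewrite tmap_comp.
have e p : (double_eval p \o γ)%VF = (α \o double_eval (α^-1%VF p))%VF.
  by apply/lfunP => y; rewrite !comp_lfunE γE.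
rewrite !e -tmap_comp !(R_eval D S h_basis hd_dual) tmap_tens (aut1 hα).
by rewrite linearZ /= (aut_counit hV) -antipodeV_automorphism αVK.
Qed.
End DoubleAutomorphism.

(** * The double of the Hom-structure as a twist of an ordinary double *)

Section Untwisting.
Variables (k : fieldType) (H : vectType k) (D : hom_data H) (S : 'End(H)).
Hypotheses (hD : is_hom_bialgebra D) (hS : is_antipode D S).
Notation Hd := 'Hom(H, k^o).
Notation HH := (tensor H Hd).
Notation α := (twist D).
Notation αV := (α^-1)%VF.
Notation D1 := (twisted D αV).
Notation "x @@ a" := (double_eval a x) (at level 35).
Notation γ := (twist (double_data D S)).

Let aD := bialg_alg hD.
Let cD := bialg_coalg hD.
Let αI : injective α := bij_inj (twist_bij_alg aD).
Let αK : cancel α αV := lfun_injK αI.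
Let αVK : cancel αV α := lfun_injVK αI.

Lemma twist_automorphism : is_hom_automorphism D α.
Proof.
split=> //.
- exact: twistM aD.
- exact: twist1 aD.
- exact: comult_twist cD.
- exact: counit_twist cD.
Qed.

Let hV := aut_inverse twist_automorphism.

Lemma twistVV : (αV^-1)%VF = α.
Proof. by apply/lfunP => x; apply: (aut_inj hV); rewrite (autVK hV) αK. Qed.

Lemma untwist_twist1 : twist D1 = \1%VF.
Proof. by apply/lfunP => x; rewrite twisted_twistE αK id_lfunE. Qed.

Lemma untwist_bialgebra : is_hom_bialgebra D1.
Proof. exact: twisted_bialgebra. Qed.

Lemma untwist_antipode : is_antipode D1 S.
Proof.
apply: twisted_antipode => // x; apply: αI.
by rewrite [RHS]αVK -(antipode_twist hS) αVK.
Qed.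

Lemma untwist_automorphism : is_hom_automorphism D1 α.
Proof.
split=> //.
- by move=> x; rewrite !twisted_twistE !αK.
- by move=> x y; rewrite !twisted_mulE -(twistM aD) αK αVK.
- exact: twist1 aD.
- by move=> x; rewrite !twisted_comultE (comult_twist cD) twistVV.
- exact: counit_twist cD.
Qed.

Lemma double_twist_eval x a : γ x @@ a = α (x @@ (αV a)).
Proof.
move: x; apply: tens_ind; [by lin|by lin|] => h f.
by rewrite tmap_tens !double_eval_tens dual_twistE linearZ.
Qed.

(** The untwisted coproduct applied twice to l gives α(l1), α^2(l21) and α^2(l22). The second is the
    origin of α^2 in the product of the double. Inside the functional the inverse twists of the
    products turn α(l1) and α^2(l22) back into l1 and l22 and leave α^{-2} on the argument. *)
Lemma double_untwist_mul x y :
  hmul (double_data D S) x y = γ (hmul (double_data D1 S) x y).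
Proof.
have bm := hmul_bilin (double_data D S); have bm1 := hmul_bilin (double_data D1 S).
move: x; apply: tens_ind; [by lin|by lin|] => h f.
move: y; apply: tens_ind; [by lin|by lin|] => l g.
rewrite !double_mulE /double_mul4 twisted_comultE twistVV tlift_tmap; last by lin.
rewrite (map_tlift (L := γ)); last by lin.
apply: eq_tlift => l1 l2.
rewrite twisted_comultE twistVV (comult_twist cD) tmap_comp tlift_tmap; last by lin.
rewrite (map_tlift (L := γ)); last by lin.
apply: eq_tlift => l21 l22.
rewrite tmap_tens untwist_twist1 !id_lfunE !comp_lfunE twisted_mulE αVK; congr (_ \ox _).
apply/lfunP => a; rewrite dual_twistE !dual_mulE twisted_comultE twistVV -(comult_twist cD) αVK.
apply: eq_tlift => a1 a2; congr (_ * _).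
rewrite !double_actE untwist_twist1 inv_lfun1 !id_lfunE !twisted_mulE !(autM hV).
by rewrite (antipode_twist hS) !αK.
Qed.

Let γ_aut : is_hom_automorphism (double_data D1 S) γ :=
  double_automorphism untwist_bialgebra untwist_twist1
    untwist_automorphism (antipode_twist hS) double_twist_eval.

Lemma double_untwist_comult x :
  comult (double_data D S) x = tmap (γ^-1)%VF (γ^-1)%VF (comult (double_data D1 S) x).
Proof.
suff <- : tmap γ γ (comult (double_data D S) x) = comult (double_data D1 S) x.
  by rewrite tmap_comp (aut_compV γ_aut) tmap_id id_lfunE.
apply: double_eval_ext2 => a b; rewrite tmap_comp.
have e p : (double_eval p \o γ)%VF = (α \o double_eval (αV p))%VF.
  by apply/lfunP => y; rewrite !comp_lfunE double_twist_eval.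
rewrite !e -tmap_comp !double_eval_comult twisted_comultE twistVV.
by rewrite twisted_mulE (autM hV).
Qed.

Lemma double_untwist : double_data D S = twisted (double_data D1 S) γ.
Proof.
have eq_data (E E' : hom_data HH) : twist E = twist E' -> mult E = mult E' ->
    hone E = hone E' -> comult E = comult E' -> counit E = counit E' -> E = E'.
  by case: E => ? ? ? ? ?; case: E' => ? ? ? ? ? /= -> -> -> -> ->.
apply: eq_data => //.
- by apply/lfunP => x; rewrite twisted_twistE (twistD1 untwist_twist1 S) id_lfunE.
- by apply: tens_ext => x y; rewrite -!/(hmul _ x y) double_untwist_mul twisted_mulE.
- by apply/lfunP => x; rewrite twisted_comultE double_untwist_comult.
Qed.
End Untwisting.

Theorem proposition4p11 (k : fieldType) (H : vectType k) (D : hom_data H)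
  (S : 'End(H)) (hH : is_hom_bialgebra D) (hS : is_antipode D S)
  (n : nat) (h : n.-tuple H) (hd : 'I_n -> 'Hom(H, k^o))
  (h_basis : basis_of fullv h)
  (hd_dual : forall i j, hd i (tnth h j) = (i == j)%:R) :
  is_quasitriangular (double_data D S)
    (\sum_(i < n) (hone D \ox hd i) \ox
                  ((S^-1)%VF (tnth h i) \ox counit D)).
Proof.
have hD1 := untwist_bialgebra hH; have tw1 := untwist_twist1 hH.
have hS1 := untwist_antipode hH hS; have hα := untwist_automorphism hH.
have γ_aut := double_automorphism hD1 tw1 hα (antipode_twist hS) (double_twist_eval D S).
have qt := double_ordinary_quasitriangular hD1 tw1 hS1 h_basis hd_dual.
have [hbD _] := qt_hopf qt.
rewrite (double_untwist hH hS).
apply: (twisted_quasitriangular γ_aut); last exact: qt.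
  exact: (double_R_automorphism hD1 tw1 hS1 hα (antipode_twist hS) (double_twist_eval D S)).
split; first exact: twisted_bialgebra.
exists (double_antipode (twisted D ((twist D)^-1)%VF) S).
apply: (twisted_antipode γ_aut); last exact: double_ordinary_antipode.
exact: (double_antipode_automorphism hD1 tw1 hS1 hα (antipode_twist hS) (double_twist_eval D S)).
Qed.
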